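(* Let $\mathcal{M}=(E,\mathcal{L},g)$ be an affine oriented matroid on $E=\{1,\dots,n,g\}$, and let $O\subseteq\mathbf{k}[x_1,\dots,x_n,y_1,\dots,y_n]$ be its oriented matroid ideal. Then $O$ is minimally generated by the monomials $m_{xy}(Z)$ corresponding to the vertices $Z$ of the bounded complex $B_\mathcal{M}$. The bounded complex $B_\mathcal{M}$ (vertex $Z$ labeled $m_{xy}(Z)$) is an $O$-complex; thus its cellular complex $C_\bullet(B_\mathcal{M},O)$ gives a minimal $\mathbb{N}^{2n}$-graded free $\mathbf{k}[\mathbf{x},\mathbf{y}]$-resolution of $O$.
   Context: Sign vectors on a finite set $E$: $X\in\{+,-,0\}^E$; $(-X)_i=-X_i$; composition $(X\circ Y)_i=X_i$ if $X_i\neq0$, else $Y_i$; separation set $S(X,Y)=\{i:X_i=-Y_i\neq0\}$. A set $\mathcal{L}\subseteq\{+,-,0\}^E$ is the set of covectors of an oriented matroid on $E$ if: $0\in\mathcal{L}$; $X\in\mathcal{L}\Rightarrow -X\in\mathcal{L}$; $X,Y\in\mathcal{L}\Rightarrow X\circ Y\in\mathcal{L}$; and if $X,Y\in\mathcal{L}$, $i\in S(X,Y)$, then some $Z\in\mathcal{L}$ has $Z_i=0$ and $Z_j=(X\circ Y)_j=(Y\circ X)_j$ for all $j\notin S(X,Y)$. Sign vectors are partially ordered componentwise by $0<+$, $0<-$. An affine oriented matroid $\mathcal{M}=(E,\mathcal{L},g)$ is such an oriented matroid with a distinguished $g\in E$ with $X_g\neq0$ for some $X\in\mathcal{L}$;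 its positive part is $\mathcal{L}^+=\{X\in\mathcal{L}:X_g=+\}$. A covector $X$ is bounded if every nonzero covector $Y\le X$ lies in $\mathcal{L}^+$. By the Topological Representation Theorem, $\mathcal{L}^+\cup\{\hat0,\hat1\}$ is the face lattice of a regular CW-complex (an arrangement of pseudohyperplanes, homeomorphic to a ball); the bounded complex $B_\mathcal{M}$ is its subcomplex formed by the cells of the nonzero bounded covectors; its face poset is the poset of bounded covectors (the zero covector being the empty cell), and its vertices are the cocircuits (minimal nonzero covectors) lying in $\mathcal{L}^+$. For $Z\in\{+,-,0\}^E$ put $m_{xy}(Z)=\prod_{i:Z_i=+}x_i\prod_{i:Z_i=-}y_i$ with $x_g=y_g=1$. The oriented matroid ideal $O$ is generated by $\{m_{xy}(Z):Z\in\mathcal{L}^+\}$. Cellular complexes: for a monomial ideal $I$ in a polynomial ring $S$ over a field $\mathbf{k}$ and a regular CW-complex $\Delta$ whose vertices are labeled by monomials generating $I$, each nonempty cell $c$ gets the label $m_c=\mathrm{lcm}$ of its vertex labels, the empty cell gets $1$; $C_\bullet(\Delta,I)$ has $C_i=\bigoplus_{\dim c=i}\langle m_c\rangle$ ($i\ge-1$, $C_{-1}=S$) and differential $\sum[c:c']\,(\text{inclusion }\langle m_c\rangle\to\langle m_{c'}\rangle)$ over codimension-one faces, $[c:c']$ incidence numbers. $\Delta_{\le m}$ is the subcomplex of cells with $m_c\mid m$. $\Delta$ is an $I$-complex if every nonempty $\Delta_{\le m}$ is acyclic over $\mathbf{k}$ and $m_c\ne m_{c'}$ whenever $c'$ is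 a proper face of $c$; ''gives a minimal free resolution of $I$'' means $C_{\ge0}$ is exact, $\mathrm{im}(C_0\to C_{-1})=I$, and it is minimal.
   Formalization: In the definition of an O-complex, the condition that m_c and m_c' differ for a proper face c' of c is required only for nonempty c'; when some covector is nonzero only at g, then O is the whole ring and the single vertex has label 1, the same as the empty cell. *)

(* Defs.v *)
From HB Require Import structures.
From mathcomp Require Export all_boot all_order all_algebra.
From mathcomp.multinomials Require Export mpoly.

Set Implicit Arguments.
Unset Strict Implicit.
Unset Printing Implicit Defensive.

Import GRing.Theory.

Local Open Scope ring_scope.

(* Signs: None is 0, Some true is +, Some false is -. *)
Definition sign : Type := option bool.
Notation szero := (None : sign) (only parsing).
Notation splus := (Some true : sign) (only parsing).
Notation sminus := (Some false : sign) (only parsing).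
Definition sopp (s : sign) : sign := omap negb s.

Definition signvec (E : finType) : finType := {ffun E -> option bool}.

Section OrientedMatroids.

Variable E : finType.
Implicit Types (X Y Z : signvec E) (L : {set signvec E}) (g : E).

Definition sv0 : signvec E := [ffun=> szero].
Definition svopp X : signvec E := [ffun i => sopp (X i)].
Definition svcomp X Y : signvec E :=
  [ffun i => if X i == szero then Y i else X i].
Definition sep X Y : {set E} := [set i | (X i != szero) && (X i == sopp (Y i))].
Definition svle X Y : bool := [forall i, (X i == szero) || (X i == Y i)].

Record oriented_matroid L : Prop := OrientedMatroid {
  om_zero : sv0 \in L;
  om_opp : forall X, X \in L -> svopp X \in L;
  om_comp : forall X Y, X \in L -> Y \in L -> svcomp X Y \in L;
  om_elim : forall X Y i, X \in L -> Y \in L -> i \in sep X Y ->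
    exists Z, [/\ Z \in L, Z i = szero &
      forall j, j \notin sep X Y ->
        Z j = svcomp X Y j /\ Z j = svcomp Y X j] }.

Definition affine_oriented_matroid L g : Prop :=
  oriented_matroid L /\ exists2 X, X \in L & X g != szero.

Definition positive_part L g : {set signvec E} :=
  [set X in L | X g == splus].

Definition cocircuits L : {set signvec E} :=
  [set X in L | (X != sv0) &&
    [forall Y in L, (Y != sv0) && svle Y X ==> (Y == X)]].

(* The zero covector is vacuously bounded; in the face poset of the bounded
   complex, ordered by svle, it is the empty cell. *)
Definition bounded_covectors L g : {set signvec E} :=
  [set X in L |
    [forall Y in L, (Y != sv0) && svle Y X ==> (Y \in positive_part L g)]].

Definition bounded_vertices L g : {set signvec E} :=
  cocircuits L :&: positive_part L g.

End OrientedMatroids.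

Section MonomialIdeals.

Variables (k : fieldType) (N : nat).
Implicit Types (T : finType) (I : {mpoly k[N]} -> Prop).

Definition monomial_ideal T (A : {set T}) (lab : T -> 'X_{1..N})
    (p : {mpoly k[N]}) : Prop :=
  exists a : T -> {mpoly k[N]}, p = \sum_(t in A) a t * 'X_[lab t].

Definition generated_by T I (A : {set T}) (lab : T -> 'X_{1..N}) : Prop :=
  forall p, I p <-> monomial_ideal A lab p.

Definition minimally_generated_by T I (A : {set T}) (lab : T -> 'X_{1..N}) :
    Prop :=
  generated_by I A lab /\
  forall A' : {set T}, A' \proper A -> ~ generated_by I A' lab.

End MonomialIdeals.

(* A finite regular CW complex is represented by its face poset: the set D of
   its cells, the empty cell included, ordered by le. *)
Section CellComplexes.

Variables (T : finType) (le : rel T) (D : {set T}).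

Definition is_chain (C : {set T}) : bool :=
  [forall x in C, forall y in C, le x y || le y x].

(* The length of a longest chain of cells ending at c. In the face poset of a
   regular CW complex this is dim c + 1: 0 for the empty cell, 1 for the
   vertices. Homological degrees are shifted by one accordingly. *)
Definition crank (c : T) : nat :=
  \max_(C : {set T} |
        (C \subset [set x in D | le x c & x != c]) && is_chain C) #|C|.

Definition facet (c' c : T) : bool :=
  [&& c' \in D, c \in D, le c' c & crank c == (crank c').+1].

(* Incidence numbers [c : c'] = inc c c' of a regular CW complex, augmented by
   [v : empty cell] = 1. These axioms determine them up to a choice of the
   orientations of the cells. *)
Record incidence_function (inc : T -> T -> int) : Prop := IncidenceFunction {
  inc_facet : forall c c', facet c' c -> inc c c' = 1 \/ inc c c' = -1;
  inc_nonfacet : forall c c', ~~ facet c' c -> inc c c' = 0;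
  inc_vertex : forall v e, facet e v -> crank e = 0%N -> inc v e = 1;
  inc_sum0 : forall c c'', \sum_(c' in D) inc c c' * inc c' c'' = 0 }.

Variable inc : T -> T -> int.

Definition boundary (A : nzRingType) (f : {ffun T -> A}) : {ffun T -> A} :=
  [ffun c' => \sum_(c in D) (inc c c')%:~R * f c].

(* The augmented cellular chains, with coefficients in k, of the subcomplex
   with set of cells A. *)
Definition cellular_chain (k : fieldType) (A : {set T}) (r : nat)
    (f : {ffun T -> k}) : Prop :=
  forall c, f c != 0 -> c \in A /\ crank c = r.

Definition acyclic (k : fieldType) (A : {set T}) : Prop :=
  forall r (f : {ffun T -> k}), cellular_chain A r f -> boundary f = 0 ->
  exists2 h : {ffun T -> k}, cellular_chain A r.+1 h & boundary h = f.

Variables (k : fieldType) (N : nat) (lab : T -> 'X_{1..N}).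

Definition complex_vertices : {set T} := [set v in D | crank v == 1%N].

Definition cell_label (c : T) : 'X_{1..N} :=
  \big[@mlcm N/0%MM]_(v in complex_vertices | le v c) lab v.

Definition sublevel (m : 'X_{1..N}) : {set T} :=
  [set c in D | (cell_label c <= m)%MM].

Record ideal_complex (I : {mpoly k[N]} -> Prop) : Prop := IdealComplex {
  icx_gen : generated_by I complex_vertices lab;
  icx_acyclic : forall m,
    (exists2 c, c \in sublevel m & (0 < crank c)%N) -> acyclic k (sublevel m);
  (* Only nonempty faces c' are meant: when I is the unit ideal a vertex may
     have the label 1 of the empty cell. *)
  icx_label : forall c c', c \in D -> c' \in D -> (0 < crank c')%N ->
    le c' c -> c' != c -> cell_label c <> cell_label c' }.

(* The module C_(r - 1), the direct sum of the principal ideals <m_c> over the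
   cells c with crank c = r, inside the functions from cells to the polynomial
   ring; the differential is boundary. *)
Definition cellular_module (r : nat) (f : {ffun T -> {mpoly k[N]}}) : Prop :=
  forall c, (exists q, f c = q * 'X_[cell_label c]) /\
            (f c != 0 -> c \in D /\ crank c = r).

End CellComplexes.

(* Complexes of submodules of the module of functions from T to S = k[N],
   N^N-graded componentwise. *)
Section Resolutions.

Variables (k : fieldType) (N : nat) (T : finType).
Let S := {mpoly k[N]}.
Implicit Types (M : {ffun T -> S} -> Prop) (f : {ffun T -> S}).

Definition homogeneous_poly (a : 'X_{1..N}) (p : S) : Prop :=
  exists x : k, p = x *: 'X_[a].

Definition homogeneous (a : 'X_{1..N}) f : Prop :=
  forall c, homogeneous_poly a (f c).

Definition graded_free M : Prop :=
  exists (r : nat) (b : 'I_r -> {ffun T -> S}),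
    (forall j, exists a, homogeneous a (b j)) /\
    (forall f, M f <-> exists! s : {ffun 'I_r -> S},
        f = [ffun c => \sum_j s j * b j c]).

(* The product of M by the maximal ideal generated by the variables. *)
Definition maxideal_mul M f : Prop :=
  exists h : 'I_N -> {ffun T -> S},
    (forall j, M (h j)) /\ f = [ffun c => \sum_j 'X_j * h j c].

Record minimal_graded_free_resolution (F : nat -> {ffun T -> S} -> Prop)
    (d : {ffun T -> S} -> {ffun T -> S}) (aug : {ffun T -> S} -> S)
    (I : S -> Prop) : Prop := MinimalGradedFreeResolution {
  res_free : forall i, graded_free (F i);
  res_map : forall i f, F i.+1 f -> F i (d f);
  res_graded : forall i a f,
    F i.+1 f -> homogeneous a f -> homogeneous a (d f);
  res_aug_graded : forall a f,
    F 0%N f -> homogeneous a f -> homogeneous_poly a (aug f);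
  res_exact : forall i f, F i.+1 f ->
    (d f = 0 <-> exists2 h, F i.+2 h & d h = f);
  res_exact0 : forall f, F 0%N f ->
    (aug f = 0 <-> exists2 h, F 1%N h & d h = f);
  res_image : forall p, I p <-> exists2 f, F 0%N f & aug f = p;
  res_minimal : forall i f, F i.+1 f -> maxideal_mul (F i) (d f) }.

End Resolutions.

(* The ground set is E = option 'I_n, with g = None. In k[n + n] the variable
   x_i has index lshift n i and y_i has index rshift n i. *)
Section OrientedMatroidIdeal.

Variables (k : fieldType) (n : nat).
Implicit Types (Z : signvec (option 'I_n)) (L : {set signvec (option 'I_n)}).

Definition xvar (e : option 'I_n) : 'X_{1..n + n} :=
  if e is Some i then U_(lshift n i)%MM else 0%MM.
Definition yvar (e : option 'I_n) : 'X_{1..n + n} :=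
  if e is Some i then U_(rshift n i)%MM else 0%MM.

Definition mxy Z : 'X_{1..n + n} :=
  (\sum_(e | Z e == splus) xvar e + \sum_(e | Z e == sminus) yvar e)%MM.

Definition om_ideal L : {mpoly k[n + n]} -> Prop :=
  monomial_ideal (positive_part L None) mxy.

End OrientedMatroidIdeal.

Arguments om_ideal k {n} L p.

(* Main.v *)
Require Import Defs.

(** No ball or sphere is available: a cell is just a covector, and acyclicity has to come from the
    covector axioms. The incidence function of the theorem lives on bounded covectors, while the
    intervals used contain unbounded covectors and covectors at infinity; this is why it is extended
    to [L]. During the extension a cell T is added when only its proper faces carry incidence
    numbers, so the sweep is made in an arbitrary face-closed [D], and its punctured form involves
    proper faces only. Integer coefficients matter at this point: comparing two normalised cycles
    gives a product equal to 1, which forces units in the integers, whereas over a field it would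
    only give nonzero scalars.

    All homology is that of subquotients on convex sets of cells: if two of a set, an order ideal in
    it and the complement are exact, so is the third. The empty cell is treated as any other cell,
    so exactness means vanishing reduced homology. The set containing the empty cell alone is not
    exact, which is why nonzero members are asked for. *)

(* The sublevel complex of a monomial consists of the bounded covectors lying in
   prescribed closed half-spaces. Mayer-Vietoris along hyperplanes reduces its
   acyclicity to the bounded faces of a single covector T. These form one fibre
   of the map sending a face X of T to its largest face at infinity; all fibres
   are acyclic by downward induction, because the intervals [U, T] are.

   Intervals are handled by a sweep (a line shelling without coordinates): a
   covector V moving from T to -T crosses the hyperplanes one at a time, and each
   crossing removes from the faces of T those lying on one facet of T but on no
   hyperplane crossed before, a set of the same kind in lower dimension. Stopping
   just before the last facet G shows that the boundary of T without G is acyclic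
   over the integers, so the facets of T carry a cycle, unique up to sign, with
   coefficients +1 and -1. This cycle gives the incidence numbers of T, whence any
   incidence function on the bounded complex extends to all covectors.

   The resolution is then obtained degree by degree. *)

Set Implicit Arguments.
Unset Strict Implicit.
Unset Printing Implicit Defensive.

Import GRing.Theory.

(** * Ranks and sign vectors *)

Section ChainRank.

Variables (T : finType) (le : rel T) (D : {set T}).
Hypotheses (le_refl : reflexive le) (le_anti : antisymmetric le).
Hypothesis le_trans : transitive le.

Let below (c : T) := [set x in D | le x c & x != c].

Lemma crank_attained c : exists C : {set T},
  [/\ C \subset below c, is_chain le C & crank le D c = #|C|].
Proof.
pose A := [set C : {set T} | (C \subset below c) && is_chain le C].
have A0 : 0 < #|A|.
  apply/card_gt0P; exists set0; rewrite inE sub0set.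
  by apply/forall_inP => x; rewrite inE.
have [C] := eq_bigmax_cond (fun C : {set T} => #|C|) A0.
rewrite inE => /andP[sC chC] E; exists C; split=> //.
by rewrite /crank -E; apply: eq_bigl => C'; rewrite inE.
Qed.

Lemma crank_ge (C : {set T}) c :
  C \subset below c -> is_chain le C -> #|C| <= crank le D c.
Proof.
move=> sC chC; rewrite /crank.
by apply: (@leq_bigmax_cond _ _ (fun C : {set T} => #|C|)); apply/andP.
Qed.

Lemma crank_lt x c :
  x \in D -> le x c -> x != c -> crank le D x < crank le D c.
Proof.
move=> xD xc nxc; have [C [sC chC ->]] := crank_attained x.
have xnC : x \notin C.
  by apply/negP => /(subsetP sC); rewrite inE eqxx andbF andbF.
have <- : #|x |: C| = #|C|.+1 by rewrite cardsU1 xnC.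
apply: crank_ge.
  apply/subsetP => y; rewrite in_setU1 => /predU1P[->|/(subsetP sC)].
    by rewrite inE xD xc nxc.
  rewrite !inE => /and3P[yD yx nyx]; rewrite yD (le_trans yx xc) /=.
  apply: contra nyx => /eqP yc; apply/eqP/le_anti.
  by rewrite yx yc xc.
have leC y : y \in C -> le y x.
  by move/(subsetP sC); rewrite inE => /and3P[].
apply/forall_inP => y; rewrite in_setU1 => yC.
apply/forall_inP => z; rewrite in_setU1 => zC.
case/predU1P: yC => [->|yC]; case/predU1P: zC => [->|zC].
- by rewrite le_refl.
- by rewrite leC // orbT.
- by rewrite leC.
- by have /forall_inP/(_ y yC)/forall_inP/(_ z zC) := chC.
Qed.

(** The predecessor is the top of a longest chain below c; the rest of that chain lies strictly
    below it. *)
Lemma crank_pred c : 0 < crank le D c ->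
  exists x, [/\ x \in D, le x c, x != c & crank le D c = (crank le D x).+1].
Proof.
have [C [sC chC eC]] := crank_attained c.
rewrite eC => /card_gt0P[x0 x0C].
(* The top of the chain is found as the member with the most chain members below it. *)
pose h x := #|[set y in C | le y x]|.
have [x xC xmax] : exists2 x, x \in C & forall y, y \in C -> h y <= h x.
  by case: (@arg_maxnP _ x0 (mem C) h x0C) => x xC xm; exists x.
have topx y : y \in C -> le y x.
  move=> yC; have /forall_inP/(_ y yC)/forall_inP/(_ x xC) := chC.
  case/orP=> // xy; have := xmax y yC.
  rewrite leqNgt => /negP; apply: contra_notT => nyx; apply: proper_card.
  apply/properP; split; last by exists y; rewrite inE yC ?le_refl.
  by apply/subsetP => z; rewrite !inE => /andP[-> /le_trans]; apply.
have /[!inE]/and3P[xD xc nxc] := subsetP sC _ xC.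
exists x; split=> //; rewrite -eC; apply/eqP; rewrite eqn_leq crank_lt // andbT.
rewrite eC (cardsD1 x) xC add1n ltnS; apply: crank_ge.
  apply/subsetP => y; rewrite !inE => /andP[nyx yC]; rewrite nyx topx // andbT /=.
  by have := subsetP sC _ yC; rewrite inE => /and3P[->].
apply/forall_inP => y /setD1P[_ yC]; apply/forall_inP => z /setD1P[_ zC].
by have /forall_inP/(_ y yC)/forall_inP/(_ z zC) := chC.
Qed.

End ChainRank.

Section SignVectors.

Variable E : finType.
Implicit Types (X Y Z U V W F G : signvec E) (s : {set E}).

Definition supp X : {set E} := [set i | X i != None].

Lemma in_supp X i : (i \in supp X) = (X i != None).
Proof. by rewrite inE. Qed.

Lemma notin_supp X i : i \notin supp X -> X i = None.
Proof. by rewrite in_supp negbK => /eqP. Qed.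

Lemma svleP X Y : reflect (forall i, i \in supp X -> X i = Y i) (svle X Y).
Proof.
apply: (iffP forallP) => H i.
  by rewrite in_supp => nz; have := H i; rewrite (negPf nz) => /eqP.
by have := H i; rewrite in_supp; case: eqP => //= _ /(_ isT) ->.
Qed.

Arguments svleP {X Y}.

Lemma svle_refl : reflexive (@svle E).
Proof. by move=> X; apply/svleP. Qed.

Lemma svle_supp X Y : svle X Y -> supp X \subset supp Y.
Proof.
by move=> /svleP H; apply/subsetP => i Xi; rewrite in_supp -H // -in_supp.
Qed.

Lemma svle_trans : transitive (@svle E).
Proof.
move=> Y X Z XY YZ; apply/svleP => i Xi; rewrite (svleP XY) //.
exact: (svleP YZ _ (subsetP (svle_supp XY) _ Xi)).
Qed.

Lemma svle_eq_supp X Y : svle X Y -> supp Y \subset supp X -> X = Y.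
Proof.
move=> /svleP XY s; apply/ffunP => i.
have [/XY //|ni] := boolP (i \in supp X).
by rewrite !notin_supp //; apply: contra ni; apply: (subsetP s).
Qed.

Lemma svle_anti : antisymmetric (@svle E).
Proof. by move=> X Y /andP[XY /svle_supp]; apply: svle_eq_supp. Qed.

Lemma svle_proper X Y : svle X Y -> X != Y -> supp X \proper supp Y.
Proof.
move=> XY nXY; rewrite properE svle_supp //=.
by apply: contra nXY => s; apply/eqP/svle_eq_supp.
Qed.

Lemma svle_subface X Y Z :
  svle X Z -> svle Y Z -> supp X \subset supp Y -> svle X Y.
Proof.
move=> /svleP XZ /svleP YZ /subsetP s; apply/svleP => i Xi.
by rewrite XZ // YZ // s.
Qed.

Lemma sv0E i : sv0 E i = None.
Proof. by rewrite ffunE. Qed.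

Lemma supp_sv0 : supp (sv0 E) = set0.
Proof. by apply/setP => i; rewrite in_supp sv0E inE. Qed.

Lemma supp_eq0 X : (supp X == set0) = (X == sv0 E).
Proof.
apply/eqP/eqP => [s0|->]; last exact: supp_sv0.
by apply/ffunP => i; rewrite sv0E notin_supp // s0 inE.
Qed.

Lemma svle0 X : svle (sv0 E) X.
Proof. by apply/svleP => i; rewrite supp_sv0 inE. Qed.

Lemma supp_opp X : supp (svopp X) = supp X.
Proof. by apply/setP => i; rewrite !in_supp ffunE; case: (X i). Qed.

Lemma svcompE X Y i : svcomp X Y i = if i \in supp X then X i else Y i.
Proof. by rewrite ffunE in_supp; case: eqP. Qed.

Lemma supp_comp X Y : supp (svcomp X Y) = supp X :|: supp Y.
Proof.
by apply/setP => i; rewrite in_setU [LHS]in_supp svcompE !in_supp; case: (X i).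
Qed.

Lemma svle_compl X Y : svle X (svcomp X Y).
Proof. by apply/svleP => i Xi; rewrite svcompE Xi. Qed.

Lemma svcomp_le X Y Z : svle X Z -> svle Y Z -> svle (svcomp X Y) Z.
Proof.
move=> /svleP XZ /svleP YZ; apply/svleP => i; rewrite supp_comp svcompE in_setU.
by have [/XZ //|_ /= /YZ] := boolP (i \in supp X).
Qed.

Lemma in_sep X Y i : (i \in sep X Y) = (i \in supp X) && (X i == svopp Y i).
Proof. by rewrite inE in_supp ffunE. Qed.

Lemma sepC X Y : sep X Y = sep Y X.
Proof.
by apply/setP => i; rewrite !inE; case: (X i) => [[]|]; case: (Y i) => [[]|].
Qed.

Lemma sep_sub X Y : sep X Y \subset supp X.
Proof. by apply/subsetP => i; rewrite in_sep => /andP[]. Qed.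

Lemma notin_sep X Y i :
  i \in supp X -> i \in supp Y -> i \notin sep X Y -> X i = Y i.
Proof.
by rewrite !inE; case: (X i) => [[]|]; case: (Y i) => [[]|].
Qed.

Lemma in_sep_neq X Y i : i \in sep X Y -> X i != Y i.
Proof. by rewrite !inE; case: (X i) => [[]|]; case: (Y i) => [[]|]. Qed.

Lemma svoppK X : svopp (svopp X) = X.
Proof. by apply/ffunP => i; rewrite !ffunE; case: (X i) => [[]|]. Qed.

End SignVectors.

Arguments svleP {E X Y}.

(** * Covers and ranks of covectors *)

Section Covectors.

Variables (E : finType) (L : {set signvec E}).
Hypothesis hL : oriented_matroid L.
Implicit Types (X Y Z U V W F G T : signvec E) (s : {set E}).

(* Walking from V towards V' until the first hyperplane separating them is
   reached, without crossing any. *)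
Lemma conformal_elimination V V' : V \in L -> V' \in L ->
    supp V' \subset supp V -> sep V V' != set0 ->
  exists W, [/\ W \in L, svle W V, (forall i, i \notin sep V V' -> W i = V i) &
    exists2 e, e \in sep V V' & W e = None].
Proof.
move=> VL; have [m] := ubnP #|sep V V'|.
elim: m V' => // m IH V' lem V'L sV'V /set0Pn[e eS].
have [Z [ZL Ze ZV]] := om_elim hL VL V'L eS.
have Zoff i : i \notin sep V V' -> Z i = V i.
  move=> /ZV[-> _]; rewrite svcompE; case: ifP => // /negbT Vi.
  rewrite !notin_supp //; apply: contra Vi; exact: (subsetP sV'V).
have sZV : supp Z \subset supp V.
  apply/subsetP => i; have [/(subsetP (sep_sub _ _)) //|/Zoff E0] := boolP (i \in sep V V').
  by rewrite !in_supp E0.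
(* Z vanishes at e, so e leaves the separation set, and Z can take the place of V'. *)
have sS : sep V Z \proper sep V V'.
  apply/properP; split; last first.
    by exists e => //; rewrite in_sep ffunE Ze /= in_supp; case: (V e).
  apply/subsetP => i; apply: contraLR => /Zoff E0.
  by apply/negP => /in_sep_neq; rewrite E0 eqxx.
have [S0|S0] := eqVneq (sep V Z) set0.
  exists Z; split=> //; last by exists e.
  apply/svleP => i Zi; apply/esym/notin_sep => //; first exact: (subsetP sZV).
  by rewrite S0 inE.
have [|W [WL WV Woff [e' e'S We']]] := IH Z _ ZL sZV S0.
  by apply: leq_trans (proper_card sS) _; rewrite -ltnS.
exists W; split=> //.
  move=> i ni; apply: Woff; apply: contra ni; exact: (subsetP (proper_sub sS)).
by exists e' => //; apply: (subsetP (proper_sub sS)).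
Qed.

(** Composition is the join of two faces of T, so a face of maximal support with a
    composition-stable property absorbs all the others. *)
Lemma max_face T (Pr : pred (signvec E)) X0 :
    (forall X Y, Pr X -> Pr Y -> Pr (svcomp X Y)) ->
    X0 \in L -> svle X0 T -> Pr X0 ->
  exists M, [/\ M \in L, svle M T, Pr M &
    forall X, X \in L -> svle X T -> Pr X -> svle X M].
Proof.
move=> PrC X0L X0T PX0.
pose A X := [&& X \in L, svle X T & Pr X].
have A0 : A X0 by apply/and3P.
case: (@arg_maxnP _ X0 A (fun X => #|supp X|) A0) => M /and3P[ML MT PM] Mmax.
exists M; split=> // X XL XT PX; apply: (svle_subface XT MT).
have AMX : A (svcomp M X).
  by apply/and3P; split; [apply: om_comp|apply: svcomp_le|apply: PrC].
have sM : supp M \subset supp (svcomp M X) by rewrite supp_comp subsetUl.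
have /eqP -> : supp M == supp (svcomp M X) by rewrite eqEcard sM; apply: Mmax.
by rewrite supp_comp subsetUr.
Qed.

Definition cover G F : bool :=
  [&& G \in L, F \in L, svle G F, G != F &
    [forall X in L, svle G X && svle X F ==> (X == G) || (X == F)]].

Lemma coverP G F : reflect [/\ G \in L, F \in L, svle G F, G != F &
    forall X, X \in L -> svle G X -> svle X F -> X = G \/ X = F] (cover G F).
Proof.
apply: (iffP and5P) => -[GL FL GF nGF H]; split=> //.
  move=> X XL GX XF; have := forall_inP H X XL.
  by rewrite GX XF => /orP[]/eqP ->; [left|right].
apply/forall_inP => X XL; apply/implyP => /andP[GX XF].
by case: (H X XL GX XF) => ->; rewrite eqxx ?orbT.
Qed.

Arguments coverP {G F}.

Lemma cover_above X F : X \in L -> F \in L -> svle X F -> X != F ->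
  exists2 G, cover G F & svle X G.
Proof.
move=> XL FL XF nXF.
pose A Y := [&& Y \in L, svle X Y, svle Y F & Y != F].
have AX : A X by rewrite /A XL svle_refl XF.
case: (@arg_maxnP _ X A (fun X => #|supp X|) AX) => G /and4P[GL XG GF nGF] Gmax.
exists G => //; apply/coverP; split=> // Y YL GY YF.
have [->|nYF] := eqVneq Y F; [by right|left].
have AY : A Y by rewrite /A YL YF nYF (svle_trans XG GY).
apply/esym/svle_eq_supp => //; have := Gmax Y AY.
by move: (svle_supp GY) => s c; have /eqP -> : supp G == supp Y by rewrite eqEcard s.
Qed.

Lemma cover_facet0 G F : cover G F -> exists i, i \in supp F :\: supp G.
Proof.
case/coverP => _ _ GF nGF _; have [_ [i iF iG]] := properP (svle_proper GF nGF).
by exists i; rewrite inE iG.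
Qed.

(** Walking from F towards [svcomp G Z] never loses G, so the first stop lies in [G, F] and is not
    F: it is G. All hyperplanes containing G but not F are therefore crossed at once. *)
Lemma cover_sep_all G F Z e f : cover G F -> Z \in L -> supp Z \subset supp F ->
    e \in supp F :\: supp G -> f \in supp F :\: supp G -> f \in sep F Z ->
  e \in sep F Z.
Proof.
case/coverP => GL FL GF nGF cGF ZL sZ /setDP[eF eG] /setDP[fF fG] fS.
have sepE i : (i \in sep F (svcomp G Z)) = (i \notin supp G) && (i \in sep F Z).
  rewrite !in_sep [svopp (svcomp G Z) i]ffunE svcompE [svopp Z i]ffunE.
  have [iG|//] := boolP (i \in supp G); rewrite -(svleP GF i iG).
  by move: iG; rewrite in_supp; case: (G i) => [[]|]; rewrite ?andbF.
have [||||W [WL WF Woff [e' e'S We']]] := @conformal_elimination F (svcomp G Z).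
- by [].
- exact: om_comp.
- by rewrite supp_comp subUset sZ svle_supp.
- by apply/set0Pn; exists f; rewrite sepE fG.
have GW : svle G W.
  apply/svleP => i iG; rewrite Woff ?sepE ?iG //; exact: (svleP GF).
have [EW|EW] := cGF W WL GW WF; last first.
  by move: e'S; rewrite in_sep in_supp -EW We'.
have We : W e = None by rewrite EW notin_supp.
have : e \in sep F (svcomp G Z).
  by apply: contraTT eF => /Woff; rewrite We in_supp => <-.
by rewrite sepE => /andP[].
Qed.

(* Elements outside G are parallel in the flat spanned by F. *)
Lemma cover_parallel G F Z e f : cover G F -> Z \in L -> supp Z \subset supp F ->
  e \in supp F :\: supp G -> f \in supp F :\: supp G ->
  e \in supp Z -> f \in supp Z.
Proof.
move=> cGF ZL sZ eP fP eZ.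
have sepsupp X Y i : i \in sep X Y -> i \in supp Y.
  by rewrite sepC => /(subsetP (sep_sub _ _)).
have [eS|eS] := boolP (e \in sep F Z).
  exact/(@sepsupp F)/(cover_sep_all cGF ZL sZ fP eP eS).
rewrite -supp_opp; apply/(@sepsupp F)/(@cover_sep_all G F _ _ e) => //.
- exact: om_opp.
- by rewrite supp_opp.
have eF : e \in supp F by case/setDP: eP.
by rewrite in_sep svoppK eF (notin_sep eF eZ eS) /=.
Qed.

Lemma cover_by_supp G F : G \in L -> F \in L -> svle G F -> G != F ->
    (forall X, X \in L -> supp G \subset supp X -> supp X \subset supp F ->
      supp X = supp G \/ supp X = supp F) -> cover G F.
Proof.
move=> GL FL GF nGF H; apply/coverP; split=> // X XL GX XF.
case: (H X XL (svle_supp GX) (svle_supp XF)) => Es; [left|right].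
  by apply/esym/svle_eq_supp => //; rewrite Es.
by apply/svle_eq_supp => //; rewrite Es.
Qed.

Definition covector_supports : {set {set E}} := [set supp X | X in L].

(** The rank in the lattice of flats. Supports, unlike covectors, stay comparable when signs change,
    as they do in the eliminations behind semimodularity. *)
Definition srank X : nat :=
  crank (fun A B : {set E} => A \subset B) covector_supports (supp X).

Let subset_refl : reflexive (fun A B : {set E} => A \subset B).
Proof. by move=> A; apply: subxx. Qed.
Let subset_anti : antisymmetric (fun A B : {set E} => A \subset B).
Proof. by move=> A B; rewrite -eqEsubset => /eqP. Qed.
Let subset_tr : transitive (fun A B : {set E} => A \subset B).
Proof. by move=> B A C; apply: subset_trans. Qed.

Lemma supp_in_supports X : X \in L -> supp X \in covector_supports.
Proof. by move=> XL; apply: imset_f. Qed.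

Lemma srank_lt X Y : X \in L -> supp X \proper supp Y -> srank X < srank Y.
Proof.
move=> XL /properP[s [i iY iX]]; apply: crank_lt => //; first exact: supp_in_supports.
by apply: contra iX => /eqP ->.
Qed.

Lemma srank_pred F : 0 < srank F ->
  exists Y, [/\ Y \in L, supp Y \proper supp F & srank F = (srank Y).+1].
Proof.
case/(crank_pred subset_refl subset_anti subset_tr) => A [/imsetP[Y YL ->] s n Er].
exists Y; split=> //; rewrite properE s /=; apply: contra n => s'.
by rewrite eqEsubset s.
Qed.

Lemma srank_sub X Y : X \in L -> supp X \subset supp Y -> srank X <= srank Y.
Proof.
move=> XL s; have [Es|n] := eqVneq (supp X) (supp Y); first by rewrite /srank Es.
by apply/ltnW/srank_lt => //; rewrite properEneq n.
Qed.

(* Semimodularity of the lattice of flats, read on the complementary supports. *)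
Lemma supp_meet_cover G F Y : cover G F -> Y \in L -> supp Y \subset supp F ->
    ~~ (supp Y \subset supp G) ->
  exists M, [/\ cover M (svcomp M Y), supp (svcomp M Y) = supp Y &
                supp M \subset supp G].
Proof.
move=> cGF YL sYF nYG.
have [GL FL _ _ _] := coverP cGF.
pose A X := [&& X \in L, supp X \subset supp Y & supp X \subset supp G].
have A0 : A (sv0 E) by rewrite /A (om_zero hL) supp_sv0 !sub0set.
case: (@arg_maxnP _ _ A (fun X => #|supp X|) A0) => M /and3P[ML MY MG] Mmax.
have Mtop X : A X -> supp X \subset supp M.
  move=> /and3P[XL XY XG].
  have AMX : A (svcomp M X).
    by rewrite /A (om_comp hL) //= supp_comp !subUset MY XY MG XG.
  have sM : supp M \subset supp (svcomp M X) by rewrite supp_comp subsetUl.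
  have /eqP -> : supp M == supp (svcomp M X) by rewrite eqEcard sM; apply: Mmax.
  by rewrite supp_comp subsetUr.
have EY : supp (svcomp M Y) = supp Y by rewrite supp_comp; apply/setUidPr.
exists M; split=> //.
have [p pY pG] := subsetPn nYG.
have pP : p \in supp F :\: supp G by rewrite inE pG (subsetP sYF).
apply: cover_by_supp => //.
- exact: om_comp.
- exact: svle_compl.
- apply: contraTneq pY => EM; rewrite -EY -EM; apply: contra pG.
  exact: (subsetP MG).
move=> X XL sMX; rewrite EY => sXY.
(* If X stays inside G, the maximality of M decides. Otherwise X contains p by parallelism and must
   be shown to contain all of Y. *)
have [sXG|nXG] := boolP (supp X \subset supp G).
  left; apply/eqP; rewrite eqEsubset sMX andbT.
  by apply: Mtop; rewrite /A XL sXY.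
have [q qX qG] := subsetPn nXG.
have sXF := subset_trans sXY sYF.
have qP : q \in supp F :\: supp G by rewrite inE qG (subsetP sXF).
have pX := cover_parallel cGF XL sXF qP pP qX.
right; apply/eqP; rewrite eqEsubset sXY /=.
have [X' [X'L EX' pS]] : exists X', [/\ X' \in L, supp X' = supp X & p \in sep Y X'].
  have [pS|pS] := boolP (p \in sep Y X); first by exists X.
  exists (svopp X); rewrite supp_opp; split=> //; first exact: om_opp.
  by rewrite in_sep svoppK pY (notin_sep pY pX pS) /=.
(* Z vanishes at p, hence by parallelism on all of F outside G, so its support lies in those of Y
   and G, thus in that of M and in that of X. An element of Y missing from X would not be separated
   and would survive in Z. *)
have [Z [ZL Zp ZE]] := om_elim hL YL X'L pS.
have sZY : supp Z \subset supp Y.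
  apply/subsetP => i; have [/(subsetP (sep_sub _ _))//|/ZE[Ei _]] := boolP (i \in sep Y X').
  rewrite in_supp Ei -in_supp supp_comp EX' in_setU => /orP[//|].
  exact: (subsetP sXY).
have sZG : supp Z \subset supp G.
  apply/subsetP => i iZ; have iF := subsetP (subset_trans sZY sYF) _ iZ.
  apply: contraT => iG.
  have iP : i \in supp F :\: supp G by rewrite inE iG.
  have := cover_parallel cGF ZL (subset_trans sZY sYF) iP pP iZ.
  by rewrite in_supp Zp.
have sZX : supp Z \subset supp X.
  by apply: subset_trans sMX; apply: Mtop; rewrite /A ZL sZY.
apply/subsetP => i iY; apply: contraT => iX.
have iS : i \notin sep Y X' by rewrite sepC in_sep EX' (negPf iX).
have [Ei _] := ZE i iS.
have : i \in supp Z by rewrite in_supp Ei -in_supp supp_comp inE iY.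
by move/(subsetP sZX); rewrite (negPf iX).
Qed.

(** Let Y be the flat just below F on a longest chain. If Y is not inside G, semimodularity gives a
    cover from M to Y with M inside G; by induction Y has rank one more than M, and M is strictly
    inside G. *)
Lemma srank_cover G F : cover G F -> srank F = (srank G).+1.
Proof.
have [m] := ubnP #|supp F|; elim: m G F => // m IH G F leF cGF.
have [GL FL GF nGF _] := coverP cGF.
have pGF := svle_proper GF nGF.
have ltGF : srank G < srank F by apply: srank_lt.
apply/eqP; rewrite eqn_leq ltGF andbT.
have [Y [YL pYF ->]] := srank_pred (leq_ltn_trans (leq0n _) ltGF).
rewrite ltnS; have [sYG|nYG] := boolP (supp Y \subset supp G).
  exact: srank_sub.
have sYF := proper_sub pYF.
have [M [cM EM MG]] := supp_meet_cover cGF YL sYF nYG.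
have -> : srank Y = srank (svcomp M Y) by rewrite /srank EM.
rewrite (IH _ _ _ cM); last first.
  by rewrite EM; apply: leq_trans (proper_card pYF) _; rewrite -ltnS.
have [ML _ _ _ _] := coverP cM.
apply: srank_lt => //; rewrite properEneq MG andbT.
(* If M had the support of G, then Y would contain G and one parallel element of F outside G, hence
   all of F. *)
apply/eqP => EMG; have [_ [i iF iY]] := properP pYF.
have sGY : supp G \subset supp Y by rewrite -EMG -EM supp_comp subsetUl.
have [q qY qG] := subsetPn nYG.
have qP : q \in supp F :\: supp G by rewrite inE qG (subsetP sYF).
have iP : i \in supp F :\: supp G.
  by rewrite inE iF andbT; apply: contra iY; apply: (subsetP sGY).
by rewrite (cover_parallel cGF YL sYF qP iP qY) in iY.
Qed.

Definition face_closed (D : {set signvec E}) : Prop :=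
  D \subset L /\ forall X Y, X \in L -> Y \in D -> svle X Y -> X \in D.

(** Chains of faces and chains of flats both grow by one along a cover. Ranks therefore agree in all
    face-closed sets: the bounded complex, [L], and the stages of the extension of incidence
    numbers. *)
Lemma crank_face_closed D c : face_closed D -> c \in D ->
  crank (@svle E) D c = srank c.
Proof.
move=> [sD idD]; have [m] := ubnP #|supp c|; elim: m c => // m IH c lec cD.
have IH' x : x \in D -> svle x c -> x != c -> crank (@svle E) D x = srank x.
  move=> xD xc nxc; apply: IH => //.
  by apply: leq_trans (proper_card (svle_proper xc nxc)) _; rewrite -ltnS.
have cL := subsetP sD _ cD.
apply/eqP; rewrite eqn_leq; apply/andP; split.
  have [->//|] := posnP (crank (@svle E) D c).
  case/(crank_pred (@svle_refl E) (@svle_anti E) (@svle_trans E)) => x [xD xc nxc ->].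
  by rewrite IH' // srank_lt ?(subsetP sD) // svle_proper.
have [c0|c0] := eqVneq (sv0 E) c.
  have [->//|] := posnP (srank c); case/srank_pred => Y [_].
  by rewrite -c0 supp_sv0 properE sub0set andbF.
have [G cGF _] := cover_above (om_zero hL) cL (svle0 c) c0.
have [GL _ GF nGF _] := coverP cGF.
have GD : G \in D by apply: idD GF.
rewrite (srank_cover cGF) -IH' //.
exact: (crank_lt (@svle_refl E) (@svle_anti E) (@svle_trans E)).
Qed.

Lemma cover_of_srank X F : X \in L -> F \in L -> svle X F ->
  srank F = (srank X).+1 -> cover X F.
Proof.
move=> XL FL XF rF; apply/coverP; split=> //.
  by apply/eqP => E1; move/eqP: rF; rewrite E1 eqn_leq ltnn andbF.
move=> Y YL XY YF; have [->|n1] := eqVneq Y X; first by left.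
have [->|n2] := eqVneq Y F; first by right.
rewrite eq_sym in n1.
have := srank_lt YL (svle_proper YF n2); rewrite rF ltnS leqNgt.
by rewrite (srank_lt XL (svle_proper XY n1)).
Qed.

Lemma facet_cover D c' c : face_closed D ->
  facet (@svle E) D c' c = [&& c' \in D, c \in D & cover c' c].
Proof.
move=> hD; rewrite /facet; have [sD _] := hD.
have [c'D|//] := boolP (c' \in D); have [cD|//] := boolP (c \in D) => /=.
rewrite !crank_face_closed //; apply/andP/idP => [[le1 /eqP r1]|cov1].
  by apply: cover_of_srank => //; apply: (subsetP sD).
by have [_ _ -> _ _] := coverP cov1; rewrite (srank_cover cov1).
Qed.

Lemma srank_eq0 X : X \in L -> (srank X == 0) = (X == sv0 E).
Proof.
move=> XL; have [->|X0] := eqVneq X (sv0 E).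
  apply/eqP; have [//|/srank_pred[Y [_ + _]]] := posnP (srank (sv0 E)).
  by rewrite supp_sv0 properE sub0set andbF.
apply/negbTE; rewrite -lt0n.
suff : srank (sv0 E) < srank X by apply: leq_ltn_trans.
apply: srank_lt; first exact: om_zero hL.
by rewrite supp_sv0 properE sub0set subset0 supp_eq0.
Qed.

(** Take a face Y of X of least support among those containing i. A nonzero Z strictly below Y would
    miss i; walking from Y towards -Z would then stop at a smaller face that still contains i. *)
Lemma cocircuit_below X i : X \in L -> i \in supp X ->
  exists Y, [/\ Y \in cocircuits L, svle Y X & i \in supp Y].
Proof.
move=> XL iX; pose A Y := [&& Y \in L, svle Y X & i \in supp Y].
have AX : A X by rewrite /A XL svle_refl.
case: (@arg_minnP _ X A (fun X => #|supp X|) AX) => Y /and3P[YL YX iY] Ymin.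
exists Y; split=> //; rewrite inE YL /=; apply/andP; split.
  by rewrite -supp_eq0; apply/set0Pn; exists i.
apply/forall_inP => Z ZL; apply/implyP => /andP[Z0 ZY]; apply: contraT => nZY.
have minY W : W \in L -> svle W Y -> W != Y -> i \notin supp W.
  move=> WL WY nWY; apply: contraT; rewrite negbK => iW.
  have /Ymin : A W by rewrite /A WL iW (svle_trans WY YX).
  by rewrite leqNgt (proper_card (svle_proper WY nWY)).
have iZ := minY Z ZL ZY nZY.
have sepE j : (j \in sep Y (svopp Z)) = (j \in supp Z).
  rewrite in_sep svoppK; apply/andP/idP => [[jY /eqP YZ]|jZ].
    by rewrite in_supp -YZ -in_supp.
  by rewrite (svleP ZY) // eqxx (subsetP (svle_supp ZY)).
have [||||W [WL WY Woff [e eS We]]] := @conformal_elimination Y (svopp Z).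
- by [].
- exact: om_opp.
- by rewrite supp_opp svle_supp.
- rewrite -supp_eq0 in Z0; have [j jZ] := set0Pn _ Z0.
  by apply/set0Pn; exists j; rewrite sepE.
have nWY : W != Y.
  apply: contraTneq eS => EW; rewrite sepE; apply/negP => /(subsetP (svle_supp ZY)).
  by rewrite in_supp -EW We.
have := minY W WL WY nWY; rewrite in_supp Woff ?sepE // -in_supp iY.
by [].
Qed.

End Covectors.

Arguments coverP {E L G F}.

(** * Exact subquotients of a cellular complex *)

Section Exactness.

Local Open Scope ring_scope.

Variables (T : finType) (le : rel T) (D : {set T}) (inc : T -> T -> int).
Hypothesis inc_le : forall c c', inc c c' != 0 -> [/\ c \in D, c' \in D & le c' c].
Hypothesis inc_sq : forall c c'', \sum_(c' in D) inc c c' * inc c' c'' = 0.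
Variable A : nzRingType.
Implicit Types (f h u : {ffun T -> A}) (P Q I : {set T}).

Notation bd := (boundary D inc (A := A)).

Definition chain_on Q f : Prop := forall c, c \notin Q -> f c = 0.

Definition restrict Q f : {ffun T -> A} := [ffun c => if c \in Q then f c else 0].

(* Exactness of the subquotient complex whose cells are those of a convex set Q. *)
Definition exact_on Q : Prop := forall f, chain_on Q f ->
  (forall c, c \in Q -> bd f c = 0) ->
  exists2 h, chain_on Q h & forall c, c \in Q -> bd h c = f c.

Definition convex Q : Prop := forall a b x,
  a \in Q -> b \in Q -> x \in D -> le a x -> le x b -> x \in Q.

Definition ideal_of Q I : Prop :=
  I \subset Q /\ forall x y, x \in Q -> y \in I -> le x y -> x \in I.

Lemma boundaryD f h : bd (f + h) = bd f + bd h.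
Proof.
by apply/ffunP => c; rewrite !ffunE -big_split; apply: eq_bigr => x _; rewrite ffunE mulrDr.
Qed.

Lemma boundaryN f : bd (- f) = - bd f.
Proof.
by apply/ffunP => c; rewrite !ffunE -sumrN; apply: eq_bigr => x _; rewrite ffunE mulrN.
Qed.

Lemma boundary_sq f : bd (bd f) = 0.
Proof.
apply/ffunP => c''; rewrite !ffunE.
under eq_bigr => c' _ do rewrite ffunE mulr_sumr.
rewrite exchange_big /= big1 // => c _.
under eq_bigr => c' _ do rewrite mulrA -intrM [inc c' c'' * _]mulrC.
by rewrite -mulr_suml -raddf_sum /= inc_sq mulr0z mul0r.
Qed.

Lemma boundary_neq0_inc f c' : bd f c' != 0 -> exists2 c, f c != 0 & inc c c' != 0.
Proof.
move=> nz; have [c /andP[fc ic]] : exists c, (f c != 0) && (inc c c' != 0).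
  apply/existsP; apply: contraNT nz => /existsPn H; rewrite ffunE big1 // => c _.
  have := H c; rewrite negb_and !negbK => /orP[]/eqP ->; first by rewrite mulr0.
  by rewrite mulr0z mul0r.
by exists c.
Qed.

Lemma boundary_neq0 f c' : bd f c' != 0 ->
  exists c, [/\ f c != 0, c \in D, c' \in D & le c' c].
Proof. by case/boundary_neq0_inc => c fc /inc_le[]; exists c. Qed.

Lemma chain_restrict Q f : chain_on Q (restrict Q f).
Proof. by move=> c /negPf Qc; rewrite ffunE Qc. Qed.

Lemma chain_in Q f c : chain_on Q f -> f c != 0 -> c \in Q.
Proof. by move=> Qf; apply: contraR => /Qf ->. Qed.

Lemma chain_onS P Q f : P \subset Q -> chain_on P f -> chain_on Q f.
Proof. by move=> s Pf c cQ; apply: Pf; apply: contra cQ; apply: (subsetP s). Qed.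

Lemma chain_onB Q f h : chain_on Q f -> chain_on Q h -> chain_on Q (f - h).
Proof. by move=> Qf Qh c cQ; rewrite !ffunE Qf ?Qh ?subr0. Qed.

Lemma chain_onD Q f h : chain_on Q f -> chain_on Q h -> chain_on Q (f + h).
Proof. by move=> Qf Qh c cQ; rewrite !ffunE Qf ?Qh ?addr0. Qed.

Lemma chainBE f h c : (f - h) c = f c - h c.
Proof. by rewrite !ffunE. Qed.

Lemma boundaryB f h c : bd (f - h) c = bd f c - bd h c.
Proof. by rewrite boundaryD boundaryN !ffunE. Qed.

Lemma boundary_ideal Q I f c :
  ideal_of Q I -> chain_on I f -> c \in Q :\: I -> bd f c = 0.
Proof.
move=> [sIQ idI] fI /setDP[cQ cI]; apply/eqP; apply: contraR cI.
by case/boundary_neq0 => x [/(chain_in fI) xI _ _ cx]; apply: idI cx.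
Qed.

(** The part of the boundary discarded by the restriction cannot reach Q again: a discarded cell
    between two cells of Q would belong to Q by convexity. *)
Lemma boundary_restrict Q f c : convex Q -> chain_on Q f -> c \in Q ->
  bd (restrict Q (bd f)) c = 0.
Proof.
move=> cvQ Qf cQ.
have -> : restrict Q (bd f) = bd f - restrict (~: Q) (bd f).
  by apply/ffunP => x; rewrite !ffunE in_setC; case: (x \in Q); rewrite ?subr0 ?subrr.
rewrite boundaryB boundary_sq ffunE sub0r; apply/eqP; rewrite oppr_eq0.
apply: contraLR cQ; case/boundary_neq0 => x [].
rewrite ffunE in_setC; case: ifP => [xQ|_]; last by rewrite eqxx.
case/boundary_neq0 => y [/(chain_in Qf) yQ _ xD xy] _ _ cx.
by apply: contra xQ => cQ; apply: (cvQ c y).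
Qed.

Lemma exact_on_set0 : exact_on set0.
Proof. by move=> f f0 _; exists 0 => // c; rewrite ?inE ?ffunE. Qed.

(** This lemma and the next two are the three cases of the long exact sequence of the pair (Q, I).
    Here a filling modulo I comes first, and the remaining error is a cycle of I. *)
Lemma exact_on_glue Q I : convex Q -> ideal_of Q I ->
  exact_on I -> exact_on (Q :\: I) -> exact_on Q.
Proof.
move=> cvQ idI exI exJ f Qf f0; have [sIQ _] := idI.
have fE : f = restrict I f + restrict (Q :\: I) f.
  apply/ffunP => x; rewrite !ffunE inE; case: ifP => /= xI; first by rewrite addr0.
  by rewrite add0r; case: ifP => // /negbT/Qf.
have [c cJ|h Jh hE] := exJ _ (@chain_restrict (Q :\: I) f).
  have := f0 c; rewrite {1}fE boundaryD ffunE.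
  rewrite (boundary_ideal idI (@chain_restrict I f) cJ) add0r; apply.
  by case/setDP: cJ.
have Qh : chain_on Q h by apply: chain_onS Jh; apply: subsetDl.
pose f1 := f - restrict Q (bd h).
have If1 : chain_on I f1.
  move=> c cI; rewrite !ffunE; case: ifP => cQ; last by rewrite Qf ?cQ // subr0.
  have cJ : c \in Q :\: I by rewrite inE cI.
  by have := hE c cJ; rewrite !ffunE cJ => ->; rewrite subrr.
have [c cI|h1 Ih1 h1E] := exI _ If1.
  have cQ := subsetP sIQ _ cI.
  by rewrite boundaryB f0 // boundary_restrict // subrr.
exists (h + h1); first by apply: chain_onD => //; apply: chain_onS Ih1.
move=> c cQ; rewrite boundaryD ffunE.
have [cI|cI] := boolP (c \in I).
  by rewrite h1E // /f1 chainBE [restrict _ _ _]ffunE cQ addrC subrK.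
have cJ : c \in Q :\: I by rewrite inE cI.
by rewrite hE // (boundary_ideal idI Ih1 cJ) addr0 ffunE cJ.
Qed.

(** A filling found in Q has a part outside I that is a cycle modulo I; subtracting the boundary of
    a chain that fills it pushes the filling into I. *)
Lemma exact_on_sub Q I : convex Q -> ideal_of Q I ->
  exact_on Q -> exact_on (Q :\: I) -> exact_on I.
Proof.
move=> cvQ idI exQ exJ f If f0; have [sIQ _] := idI.
have [c cQ|h Qh hE] := exQ f (chain_onS sIQ If).
  have [/f0 //|cI] := boolP (c \in I).
  by apply: (boundary_ideal idI If); rewrite inE cI.
have hEJ : h = restrict I h + restrict (Q :\: I) h.
  apply/ffunP => x; rewrite !ffunE inE; case: ifP => /= xI; first by rewrite addr0.
  by rewrite add0r; case: ifP => // /negbT/Qh.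
have [c cJ|u Ju uE] := exJ _ (@chain_restrict (Q :\: I) h).
  have [cQ cI] := setDP cJ.
  have := hE c cQ; rewrite {1}hEJ boundaryD ffunE.
  by rewrite (boundary_ideal idI (@chain_restrict I h) cJ) add0r If.
have Qu : chain_on Q u by apply: chain_onS Ju; apply: subsetDl.
exists (h - restrict Q (bd u)).
  move=> c cI; rewrite !ffunE; case: ifP => cQ; last by rewrite Qh ?cQ // subr0.
  have cJ : c \in Q :\: I by rewrite inE cI.
  by have := uE c cJ; rewrite !ffunE cJ => ->; rewrite subrr.
move=> c cI; have cQ := subsetP sIQ _ cI.
by rewrite boundaryB hE // boundary_restrict // subr0.
Qed.

(** A cycle modulo I has its boundary in I, where it is filled; subtracting this filling makes it a
    cycle of Q. *)
Lemma exact_on_quot Q I : convex Q -> ideal_of Q I ->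
  exact_on Q -> exact_on I -> exact_on (Q :\: I).
Proof.
move=> cvQ idI exQ exI f Jf f0; have [sIQ _] := idI.
have Qf : chain_on Q f by apply: chain_onS Jf; apply: subsetDl.
have If1 : chain_on I (restrict Q (bd f)).
  move=> c cI; rewrite ffunE; case: ifP => // cQ.
  by apply: f0; rewrite inE cI.
have [c cI|h Ih hE] := exI _ If1.
  by rewrite boundary_restrict // (subsetP sIQ).
have Qfh : chain_on Q (f - h) by apply: chain_onB => //; apply: chain_onS Ih.
have [c cQ|u Qu uE] := exQ _ Qfh.
  rewrite boundaryB; have [cI|cI] := boolP (c \in I).
    by rewrite hE // [restrict _ _ _]ffunE cQ subrr.
  have cJ : c \in Q :\: I by rewrite inE cI.
  by rewrite f0 // (boundary_ideal idI Ih cJ) subrr.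
have uEJ : u = restrict I u + restrict (Q :\: I) u.
  apply/ffunP => x; rewrite !ffunE inE; case: ifP => /= xI; first by rewrite addr0.
  by rewrite add0r; case: ifP => // /negbT/Qu.
exists (restrict (Q :\: I) u); first exact: chain_restrict.
move=> c cJ; have [cQ cI] := setDP cJ.
have := uE c cQ; rewrite {1}uEJ boundaryD ffunE.
rewrite (boundary_ideal idI (@chain_restrict I u) cJ) add0r => ->.
by rewrite !ffunE Ih // subr0.
Qed.

(** The basic cancellation: the incidence number, being a sign, is its own inverse. *)
Lemma exact_on_pair a b : inc b a = 1 \/ inc b a = -1 ->
  inc a b = 0 -> inc a a = 0 -> inc b b = 0 -> exact_on [set a; b].
Proof.
move=> hba ab aa bb f Qf f0.
have nz : inc b a != 0 by case: hba => ->.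
have [bD aD _] := inc_le nz.
have nab : a != b by apply/eqP => E1; move: nz; rewrite E1 bb eqxx.
have bdE h c : chain_on [set a; b] h ->
    bd h c = (inc a c)%:~R * h a + (inc b c)%:~R * h b.
  move=> Qh; rewrite ffunE (bigD1 a) //= (bigD1 b) /=; last by rewrite bD eq_sym.
  rewrite big1 ?addr0 // => x /andP[/andP[_ xa] xb].
  by rewrite Qh ?mulr0 // !inE negb_or xa.
have fb : f b = 0.
  have := f0 a; rewrite bdE // aa mulr0z mul0r add0r !inE eqxx => /(_ isT).
  by case: hba => ->; rewrite ?mulrN1z ?mul1r ?mulN1r // => /eqP; rewrite oppr_eq0 => /eqP.
pose h : {ffun T -> A} := [ffun c => if c == b then (inc b a)%:~R * f a else 0].
have Qh : chain_on [set a; b] h.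
  by move=> c; rewrite !inE negb_or ffunE => /andP[_ /negPf ->].
exists h => // c; rewrite bdE // !ffunE eqxx (negPf nab) mulr0 add0r.
rewrite !inE => /orP[]/eqP ->; last by rewrite bb mulr0z mul0r fb.
have sq1 : inc b a * inc b a = 1 by case: hba => ->.
by rewrite mulrA -intrM sq1 mulr1z mul1r.
Qed.

Lemma convexD Q I : convex Q -> ideal_of Q I -> convex (Q :\: I).
Proof.
move=> cvQ [_ idI] a b x /setDP[aQ aI] /setDP[bQ bI] xD ax xb.
have xQ := cvQ a b x aQ bQ xD ax xb.
by rewrite inE xQ andbT; apply: contra aI => xI; apply: idI ax.
Qed.

(** A fibre over a value of least [size'] is an order ideal, so the fibres can be peeled off one by
    one and glued. *)
Lemma exact_on_fibres (T' : finType) (le' : rel T') (phi : T -> T')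
    (size' : T' -> nat) Q :
  (forall x y, le' x y -> size' y <= size' x -> x = y)%N ->
  convex Q -> (forall x y, x \in Q -> y \in Q -> le x y -> le' (phi x) (phi y)) ->
  (forall x, x \in Q -> exact_on [set y in Q | phi y == phi x]) -> exact_on Q.
Proof.
move=> sz; have [m] := ubnP #|Q|; elim: m Q => // m IH Q leQ cvQ mono fib.
have [->|/set0Pn[x0 x0Q]] := eqVneq Q set0; first exact: exact_on_set0.
case: (@arg_minnP _ x0 (mem Q) (size' \o phi) x0Q) => x.
rewrite -[mem Q x]/(x \in Q) => xQ xmin.
pose I := [set y in Q | phi y == phi x].
have idI : ideal_of Q I.
  split; first by apply/subsetP => y; rewrite inE => /andP[].
  move=> y z yQ; rewrite !inE => /andP[zQ /eqP zx] yz; rewrite yQ /=.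
  by apply/eqP/sz; [rewrite -zx; apply: mono|apply: xmin].
apply: (exact_on_glue cvQ idI); first exact: fib.
apply: IH.
- rewrite -ltnS; apply: leq_trans leQ; rewrite ltnS; apply/proper_card/properP; split.
    exact: subsetDl.
  by exists x => //; rewrite !inE xQ eqxx.
- exact: convexD.
- by move=> y z /setDP[yQ _] /setDP[zQ _]; apply: mono.
move=> y /setDP[yQ yI]; have := fib y yQ.
suff -> : [set z in Q :\: I | phi z == phi y] = [set z in Q | phi z == phi y] by [].
apply/setP => z; rewrite !inE; case: (z \in Q) => //=; rewrite ?andbF //.
have [Ezy|] := eqVneq (phi z) (phi y); rewrite ?andbF // Ezy !andbT.
by apply: contra yI => /eqP Exy; rewrite inE yQ Exy eqxx.
Qed.

(** [exact_on] ignores the grading. Since the boundary lowers the rank by exactly one, the component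
    of rank r+1 of any filling already fills a cycle of rank r. *)
Lemma exact_on_homogeneous (rk : T -> nat) Q r f :
  (forall c c', inc c c' != 0 -> rk c = (rk c').+1) ->
  exact_on Q -> chain_on Q f -> (forall c, f c != 0 -> rk c = r) ->
  (forall c, c \in Q -> bd f c = 0) ->
  exists h, [/\ chain_on Q h, forall c, h c != 0 -> rk c = r.+1 &
    forall c, c \in Q -> bd h c = f c].
Proof.
move=> rkS exQ Qf fr f0; have [h Qh hE] := exQ f Qf f0.
exists [ffun c => if rk c == r.+1 then h c else 0]; split.
- by move=> c cQ; rewrite ffunE Qh //; case: ifP.
- by move=> c; rewrite ffunE; have [//|_] := eqVneq (rk c) r.+1; rewrite eqxx.
move=> c cQ; have [rc|rc] := eqVneq (rk c) r.
  rewrite -hE // !ffunE; apply: eq_bigr => x _; rewrite ffunE.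
  case: eqP => // nx; have [->|/rkS] := eqVneq (inc x c) 0; first by rewrite mulr0z !mul0r.
  by rewrite rc.
have -> : f c = 0 by apply/eqP; apply: contraR rc => /fr ->.
rewrite ffunE big1 // => x _; rewrite ffunE; case: eqP => [rx|]; last by rewrite mulr0.
have [->|/rkS] := eqVneq (inc x c) 0; first by rewrite mulr0z !mul0r.
by rewrite rx => -[Er]; rewrite Er eqxx in rc.
Qed.

End Exactness.

(** * Sweeping the faces of a covector *)

Section Sweep.

Variables (E : finType) (L : {set signvec E}).
Hypothesis hL : oriented_matroid L.
Variables (D : {set signvec E}) (inc : signvec E -> signvec E -> int).
Hypotheses (hD : face_closed L D) (hinc : incidence_function (@svle E) D inc).
Variable A : nzRingType.
Implicit Types (X Y Z U V W F G T : signvec E) (s : {set E}).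

Lemma inc_cover c c' : inc c c' != 0%R -> [/\ c \in D, c' \in D & cover L c' c].
Proof.
move=> nz; have := contraNT (fun n => introT eqP (inc_nonfacet hinc n)) nz.
by rewrite (facet_cover hL) // => /and3P[].
Qed.

Lemma inc_le c c' : inc c c' != 0%R -> [/\ c \in D, c' \in D & svle c' c].
Proof. by case/inc_cover => cD c'D /coverP[]. Qed.

Lemma inc_sq c c'' : (\sum_(c' in D) inc c c' * inc c' c'')%R = 0%R.
Proof. exact: inc_sum0 hinc c c''. Qed.

Lemma inc_cover_unit c c' : c \in D -> c' \in D -> cover L c' c ->
  inc c c' = 1%R \/ inc c c' = (-1)%R.
Proof.
by move=> cD c'D cov; apply: (inc_facet hinc); rewrite (facet_cover hL) // c'D cD.
Qed.

Lemma inc_srank c c' : inc c c' != 0%R -> srank L c = (srank L c').+1.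
Proof. by case/inc_cover => _ _; apply: srank_cover. Qed.

(* The faces of F not lying on any of the hyperplanes in s. *)
Definition faces_off F s : {set signvec E} :=
  [set X in L | svle X F & [forall i in s, X i == F i]].

Lemma faces_offP F s X : reflect
  [/\ X \in L, svle X F & forall i, i \in s -> X i = F i] (X \in faces_off F s).
Proof.
rewrite inE; apply: (iffP and3P) => -[XL XF H]; split=> //.
  by move=> i /(forall_inP H)/eqP.
by apply/forall_inP => i /H ->.
Qed.

Lemma convex_faces_off F s : convex (@svle E) D (faces_off F s).
Proof.
move=> a b x /faces_offP[_ aF aE] /faces_offP[_ bF _] xD ax xb.
have xF := svle_trans xb bF.
apply/faces_offP; split=> //; first by apply: (subsetP hD.1).
move=> i si; have [ia|ia] := boolP (i \in supp a).
  by rewrite -(svleP ax) // aE.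
have iF : i \notin supp F by rewrite in_supp -aE // -in_supp.
by rewrite !notin_supp //; apply: contra iF; apply: (subsetP (svle_supp xF)).
Qed.

Lemma convex_ideal (Q I : {set signvec E}) :
  convex (@svle E) D Q -> ideal_of (@svle E) Q I -> convex (@svle E) D I.
Proof.
move=> cvQ [sIQ idI] a b x aI bI xD ax xb.
by apply: (idI _ b) => //; apply: (cvQ a b) => //; apply: (subsetP sIQ).
Qed.

Lemma ideal_punctured F G s : cover L G F -> 
  ideal_of (@svle E) (faces_off F s) (faces_off F s :\: [set G; F]).
Proof.
move=> /coverP[_ _ _ _ cGF]; split; first exact: subsetDl.
move=> x y xQ /setDP[/faces_offP[yL yF _] nyGF] xy; rewrite in_setD xQ andbT.
move: nyGF; apply: contra; rewrite !inE => /orP[]/eqP Ex; rewrite Ex in xy.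
  by case: (cGF y yL xy yF) => ->; rewrite eqxx ?orbT.
by rewrite (svle_anti (_ : svle y F && svle F y)) ?eqxx ?orbT // yF.
Qed.

(** [svcomp W (svopp V)] is V reflected through its face W: the newly crossed hyperplanes are those
    containing W but not V. *)
Lemma svcomp_opp_sep F V W : svle W V -> supp V = supp F ->
    (forall i, i \in supp V :\: supp W -> V i = F i) ->
  sep F (svcomp W (svopp V)) = sep F V :|: (supp V :\: supp W).
Proof.
move=> WV EV H; apply/setP => i; rewrite in_setU !in_sep !ffunE !in_supp.
have := svleP WV i; have := H i; rewrite in_setD !in_supp.
have Es : (i \in supp V) = (i \in supp F) by rewrite EV.
move: Es; rewrite !in_supp.
case: (W i) => [w|] /=.
  by move=> _ _ /(_ isT) <-; rewrite orbF.
by case: (V i) => [v|]; case: (F i) => [f|] //= _ /(_ isT) [->]; case: f.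
Qed.

Notation exact_cells := (exact_on D inc A).

(* Sweeping from V = F to V = -G o F, each crossing of a hyperplane removes
   from the punctured boundary of F the faces of one facet G1 of F, except those
   on previously crossed hyperplanes: a set of the same kind. *)
Lemma exact_faces_off_punctured F G : cover L G F ->
    (forall F' V, F' \in L -> svle F' F -> F' != F -> V \in L ->
      supp V = supp F' -> sep F' V != supp F' -> exact_cells (faces_off F' (sep F' V))) ->
  forall V, V \in L -> supp V = supp F ->
    (forall i, i \in supp F :\: supp G -> V i = F i) ->
  exact_cells (faces_off F (sep F V) :\: [set G; F]).
Proof.
move=> cGF IHF V; have [GL FL GF nGF GFmax] := coverP cGF.
have [m] := ubnP #|supp G :\: sep F V|; elim: m V => // m IH V leV VL EV VG.
set s := sep F V in leV *.
have sG i : i \in s -> i \in supp G.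
  move=> si; apply: contraT => iG; have iF := subsetP (sep_sub _ _) _ si.
  have /VG Vi : i \in supp F :\: supp G by rewrite in_setD iG.
  by have := in_sep_neq si; rewrite Vi eqxx.
have Voff i : i \in supp F -> i \notin s -> V i = F i.
  by move=> iF ns; apply/esym/notin_sep => //; rewrite EV.
(* The sweep ends when G is entirely crossed: a face of F agreeing with F on [supp G] lies above G,
   so it is G or F, and both are removed. *)
have [/eqP|/set0Pn[e0]] := eqVneq (supp G :\: s) set0.
  rewrite setD_eq0 => sGs; suff -> : faces_off F s :\: [set G; F] = set0.
    exact: exact_on_set0.
  apply/setP => X; rewrite in_set0; apply/negbTE/negP.
  case/setDP => /faces_offP[XL XF XE]; rewrite !inE => /negP; apply.
  have GX : svle G X.
    apply/svleP => i iG; rewrite XE ?(subsetP sGs) //; exact: (svleP GF).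
  by case: (GFmax X XL GX XF) => ->; rewrite eqxx ?orbT.
move=> e0t.
pose V' := svcomp (svopp G) F.
have V'L : V' \in L by rewrite (om_comp hL) ?(om_opp hL).
have sV' : supp V' = supp F by rewrite supp_comp supp_opp; apply/setUidPr/svle_supp.
have sepE i : (i \in sep V V') = (i \in supp G :\: s).
  have [iF|iF] := boolP (i \in supp F); last first.
    rewrite in_sep EV (negPf iF) /= in_setD; apply/esym/negbTE.
    by rewrite negb_and (contra (subsetP (svle_supp GF) i)) // orbT.
  have [iG|iG] := boolP (i \in supp G); last first.
    rewrite in_setD (negPf iG) andbF; apply/negbTE/negP => /in_sep_neq.
    by rewrite /V' svcompE supp_opp (negPf iG) VG ?eqxx // in_setD iG.
  rewrite in_setD iG andbT /s !in_sep EV iF /= /V'.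
  rewrite [svopp (svcomp _ _) i]ffunE svcompE supp_opp iG !ffunE (svleP GF) //.
  have : i \in supp V by rewrite EV.
  by move: iF; rewrite !in_supp; case: (V i) => [[]|]; case: (F i) => [[]|].
(* The candidates for the next wall: faces of V that vanish at some uncrossed element of G, and
   otherwise only at such elements. Largest support means that as few hyperplanes as possible are
   crossed. *)
pose B W := [&& W \in L, svle W V, [forall i, (i \in sep V V') || (W i == V i)] &
                [exists e in sep V V', W e == None]].
have [W0 BW0] : exists W, B W.
  have [||||W [WL WV Woff [e eS We]]] := @conformal_elimination _ _ hL V V'.
  - by [].
  - by [].
  - by rewrite sV' EV.
  - by apply/set0Pn; exists e0; rewrite sepE.
  exists W; apply/and4P; split=> //.
    by apply/forallP => i; case: (boolP (i \in _)) => //= /Woff ->.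
  by apply/exists_inP; exists e => //; rewrite We.
case: (@arg_maxnP _ W0 B (fun W => #|supp W|) BW0) => W.
case/and4P => WL WV /forallP Woff /exists_inP[e eS /eqP We] Wmax.
have {}Woff i : i \in supp V -> i \notin sep V V' -> i \in supp W.
  by move=> iV ni; have := Woff i; rewrite (negPf ni) /= in_supp => /eqP ->; rewrite -in_supp.
pose P := supp V :\: supp W.
have PS i : i \in P -> i \in supp G /\ i \notin s.
  case/setDP => iV iW; have : i \in sep V V' by apply: contraR iW => /Woff; apply.
  by rewrite sepE => /setDP[].
have eP : e \in P.
  by rewrite in_setD in_supp We eqxx /=; apply: (subsetP (sep_sub _ _)) eS.
have VP i : i \in P -> V i = F i.
  by move=> iP; have [iG ns] := PS i iP; apply: Voff => //; rewrite -EV; case/setDP: iP.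
(* maximality of W makes P a parallel class *)
have PX X i j : X \in L -> svle X F -> i \in P -> j \in P -> i \in supp X -> j \in supp X.
  move=> XL XF iP jP iX; apply: contraT => jX.
  have BWX : B (svcomp W X).
    rewrite /B (om_comp hL) //=; apply/and3P; split.
    - apply/svleP => x; rewrite supp_comp svcompE in_setU.
      have [xW _|xW /= xX] := boolP (x \in supp W); first exact: (svleP WV).
      have xP : x \in P by rewrite in_setD xW EV (subsetP (svle_supp XF)).
      by rewrite VP // (svleP XF).
    - apply/forallP => x; have [//|nx] := boolP (x \in sep V V').
      rewrite /= svcompE; case: ifP => [xW|/negbT xW]; first by rewrite (svleP WV).
      have xV : x \notin supp V by apply: contra xW => /Woff; apply.
      by rewrite !notin_supp //; apply: contra xV; rewrite EV; apply: (subsetP (svle_supp XF)).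
    - apply/exists_inP; exists j; last first.
        by rewrite svcompE; case/setDP: jP => _ /negPf ->; rewrite notin_supp.
      by rewrite sepE; have [? ?] := PS j jP; apply/setDP.
  have := Wmax _ BWX; rewrite /= leqNgt => /negP[]; apply: proper_card.
  apply/properP; split; first by rewrite supp_comp subsetUl.
  exists i; first by rewrite supp_comp in_setU iX orbT.
  by case/setDP: iP.
(* The position of the moving covector just behind the wall W. *)
pose V2 := svcomp W (svopp V).
have V2L : V2 \in L by rewrite (om_comp hL) ?(om_opp hL).
have EV2 : supp V2 = supp F.
  by rewrite supp_comp supp_opp -EV; apply/setUidPr/svle_supp.
have s2E : sep F V2 = s :|: P by apply: svcomp_opp_sep.
pose Q := faces_off F s :\: [set G; F].
(* The faces lost in this crossing; by [PX], vanishing at e amounts to vanishing on all of P. *)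
pose I := [set X in Q | e \notin supp X].
have idI : ideal_of (@svle E) Q I.
  split; first by apply/subsetP => X; rewrite inE => /andP[].
  move=> x y xQ; rewrite in_set => /andP[_ ey] xy; rewrite in_set xQ /=.
  by move: ey; apply: contra; apply: (subsetP (svle_supp xy)).
apply: (@exact_on_glue _ (@svle E) D inc inc_le inc_sq A Q I) => //.
- exact/(convex_ideal (@convex_faces_off F s))/ideal_punctured.
- have [->|/set0Pn[X0 X0I]] := eqVneq I set0; first exact: exact_on_set0.
  have IP X : X \in I -> [/\ X \in L, svle X F, forall i, i \in s -> X i = F i &
      forall i, i \in P -> i \notin supp X].
    rewrite inE => /andP[/setDP[/faces_offP[XL XF XE] _] eX]; split=> // i iP.
    by apply: contra eX; apply: PX.
  (* If some face is lost, all lost faces are faces of the largest face G1 of F on the crossed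
     hyperplanes. It will be shown that I is the same kind of set for G1, with W as the moving
     covector. *)
  pose Pr X := [forall i in P, i \notin supp X].
  have [X0L X0F X0E X0P] := IP X0 X0I.
  have [|||//|G1 [G1L G1F /forall_inP G1P G1max]] := @max_face _ _ hL F Pr X0.
  - move=> X Y /forall_inP XP /forall_inP YP; apply/forall_inP => i iP.
    by rewrite supp_comp in_setU negb_or XP ?YP.
  - by [].
  - by [].
  - by apply/forall_inP.
  have X0G1 : svle X0 G1 by apply: G1max => //; apply/forall_inP.
  have sF i : i \in s -> i \in supp F by apply: (subsetP (sep_sub _ _)).
  have G1E i : i \in s -> G1 i = F i.
    move=> si; rewrite -(svleP X0G1) ?X0E //.
    by rewrite in_supp X0E // -in_supp sF.
  have EG1 : supp G1 = supp W.
    apply/eqP; rewrite eqEsubset; apply/andP; split.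
      apply/subsetP => i iG1; apply: contraTT iG1 => iW.
      have [iF|iF] := boolP (i \in supp F).
        by apply: G1P; rewrite in_setD iW EV.
      by apply: contra iF; apply: (subsetP (svle_supp G1F)).
    (* G1 contains s, and off s the wall W agrees with F; hence [svcomp G1 W] is again a face of F
       vanishing on P. *)
    suff le1 : svle (svcomp G1 W) G1.
      by have := svle_supp le1; rewrite supp_comp subUset => /andP[].
    apply: G1max; first by rewrite (om_comp hL).
      apply/svleP => i; rewrite supp_comp svcompE in_setU.
      have [iG1 _|iG1 /= iW] := boolP (i \in supp G1); first exact: (svleP G1F).
      rewrite (svleP WV) //; apply: Voff.
        by rewrite -EV (subsetP (svle_supp WV)).
      by apply: contra iG1 => si; rewrite in_supp G1E // -in_supp sF.
    apply/forall_inP => i iP; rewrite supp_comp in_setU negb_or G1P //.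
    by case/setDP: iP.
  have sepG1 : sep G1 W = s.
    apply/setP => i; apply/idP/idP.
      move=> iS; have iG1 := subsetP (sep_sub _ _) _ iS.
      move: iS; rewrite in_sep ffunE (svleP WV) -?EG1 // (svleP G1F) //.
      by move=> /andP[_ H]; rewrite /s in_sep ffunE H (subsetP (svle_supp G1F)).
    move=> si; have iW : i \in supp W.
      rewrite -EG1 in_supp G1E // -in_supp; exact: sF.
    have := si; rewrite {1}/s in_sep ffunE => /andP[_ H].
    by rewrite in_sep ffunE (svleP WV) // G1E // H EG1 iW.
  have -> : I = faces_off G1 (sep G1 W).
    apply/setP => X; rewrite sepG1; apply/idP/faces_offP.
      move=> /IP[XL XF XE XP]; have XG1 : svle X G1.
        by apply: G1max => //; apply/forall_inP.
      by split=> // i si; rewrite XE // G1E.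
    move=> [XL XG1 XE]; have XF := svle_trans XG1 G1F.
    have eX : e \notin supp X.
      by apply: contra (G1P e eP); apply: (subsetP (svle_supp XG1)).
    rewrite inE eX andbT in_setD; apply/andP; split; last first.
      by apply/faces_offP; split=> // i si; rewrite XE // G1E.
    have [eG _] := PS e eP.
    rewrite !inE negb_or; apply/andP; split.
      by apply: contraNneq eX => ->.
    by apply: contraNneq eX => ->; apply: (subsetP (svle_supp GF)).
  apply: IHF => //.
    apply: contraTneq eP => EG; apply/negP => eP; have := G1P e eP.
    by rewrite EG -EV; case/setDP: eP => ->.
  (* An element p of F outside G is never crossed: it lies in W, which has the support of G1, but
     not in s. So G1 is not entirely crossed, as the induction hypothesis requires. *)
  have [p pFG] := cover_facet0 cGF; have [pF pG] := setDP pFG.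
  have pW : p \in supp W.
    by apply: Woff; rewrite ?EV // sepE in_setD (negPf pG) andbF.
  rewrite sepG1; apply: contraTneq pW => Es; rewrite -EG1 -Es.
  by apply: contra pG; apply: sG.
have -> : Q :\: I = faces_off F (sep F V2) :\: [set G; F].
  apply/setP => X; rewrite s2E inE [X \in I]inE negb_and negbK.
  rewrite [RHS]inE [X \in Q]inE.
  have [_|_] := boolP (X \in [set G; F]); rewrite ?andbF //=.
  apply/andP/faces_offP.
    case=> /orP[/negP//|eX] /faces_offP[XL XF XE]; split=> // i.
    rewrite in_setU => /orP[/XE//|iP]; apply: (svleP XF).
    exact: PX eX.
  case=> XL XF XE; split.
    rewrite in_supp XE ?in_setU ?eP ?orbT // -in_supp -EV.
    by case/setDP: eP => ->; rewrite orbT.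
  by apply/faces_offP; split=> // i si; apply: XE; rewrite in_setU si.
apply: IH => //.
- rewrite -ltnS; apply: leq_trans leV; rewrite ltnS s2E; apply: proper_card.
  have [eG es] := PS e eP; apply/properP; split.
    by apply: setDS; apply: subsetUl.
  by exists e; rewrite !in_setD ?in_setU ?eP ?orbT ?eG ?es.
move=> i iFG; have [iF iG] := setDP iFG; rewrite /V2 svcompE.
have iW : i \in supp W by apply: Woff; rewrite ?EV // sepE in_setD (negPf iG) andbF.
by rewrite iW (svleP WV) // VG.
Qed.

(** As V is not opposite to F, walking from F towards -V yields a facet G that contains everything
    crossed so far. The pair G, F is exact by itself and sits on top of the punctured set handled by
    the sweep. *)
Lemma exact_faces_off F V : F \in D -> V \in L -> supp V = supp F ->
  sep F V != supp F -> exact_cells (faces_off F (sep F V)).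
Proof.
have [m] := ubnP #|supp F|; elim: m F V => // m IH F V leF FD VL EV nsep.
have [sDL idD] := hD; have FL := subsetP sDL _ FD.
have sepE i : (i \in sep F (svopp V)) = (i \in supp F :\: sep F V).
  have [iF|iF] := boolP (i \in supp F); last by rewrite in_sep in_setD (negPf iF) andbF.
  rewrite in_setD iF andbT !in_sep iF /= !ffunE.
  have : i \in supp V by rewrite EV.
  by move: iF; rewrite !in_supp; case: (V i) => [[]|]; case: (F i) => [[]|].
have [||||W [WL WF Woff [e eS We]]] := @conformal_elimination _ _ hL F (svopp V).
- by [].
- exact: om_opp.
- by rewrite supp_opp EV.
- have : ~~ (supp F \subset sep F V).
    by apply: contra nsep => s1; rewrite eqEsubset sep_sub.
  by case/subsetPn => i iF iS; apply/set0Pn; exists i; rewrite sepE in_setD iS.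
have nWF : W != F.
  by apply: contraTneq eS => EW; rewrite in_sep in_supp -EW We.
have [G cGF WG] := cover_above WL FL WF nWF.
have [GL _ GF nGF GFmax] := coverP cGF.
have GD : G \in D by apply: idD GF.
have WE i : i \in sep F V -> W i = F i.
  by move=> iS; apply: Woff; rewrite sepE in_setD iS.
have sG i : i \in sep F V -> i \in supp G.
  move=> iS; apply: (subsetP (svle_supp WG)); rewrite in_supp WE // -in_supp.
  exact: (subsetP (sep_sub _ _) _ iS).
have idI := @ideal_punctured F G (sep F V) cGF.
apply: (exact_on_glue inc_le inc_sq (@convex_faces_off F (sep F V)) idI).
  apply: exact_faces_off_punctured => //.
    move=> F' V' F'L F'F nF'F V'L EV' nsep'; apply: IH => //; last exact: idD F'F.
    by rewrite -ltnS; apply: leq_trans leF; rewrite ltnS; apply/proper_card/svle_proper.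
  move=> i /setDP[iF iG]; apply/esym/notin_sep => //; first by rewrite EV.
  by apply: contra iG; apply: sG.
have -> : faces_off F (sep F V) :\: (faces_off F (sep F V) :\: [set G; F]) = [set G; F].
  rewrite setDDr setDv set0U; apply/setIidPr; apply/subsetP => X; rewrite !inE.
  have FF := svle_refl F.
  move=> /orP[]/eqP ->; rewrite ?GL ?FL ?GF ?FF /=; apply/forall_inP => i iS //.
  by rewrite (svleP GF) ?sG.
apply: (exact_on_pair inc_le); first exact: inc_cover_unit.
- apply/eqP; apply: contraT => /inc_le[_ _ FG].
  by case/eqP: nGF; apply: svle_anti; rewrite GF.
- by apply/eqP; apply: contraT => /inc_cover[_ _ /coverP[_ _ _]]; rewrite eqxx.
- by apply/eqP; apply: contraT => /inc_cover[_ _ /coverP[_ _ _]]; rewrite eqxx.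
Qed.

Lemma sep_opp_comp F U : svle U F -> sep F (svcomp (svopp U) F) = supp U.
Proof.
move=> /svleP UF; apply/setP => i.
rewrite in_sep [svopp _ i]ffunE svcompE supp_opp ffunE.
case: ifP => [iU|_]; first by rewrite in_supp -UF // -in_supp iU; case: (U i) => [[]|].
by rewrite in_supp; case: (F i) => [[]|].
Qed.

(** The faces of F above U are those agreeing with F on [supp U], and -U o F is the covector that
    has crossed exactly this set. *)
Lemma exact_interval U F : F \in D -> U \in L -> svle U F -> U != F ->
  exact_cells [set X in L | svle U X & svle X F].
Proof.
move=> FD UL UF nUF; have FL := subsetP hD.1 _ FD.
have -> : [set X in L | svle U X & svle X F] =
          faces_off F (sep F (svcomp (svopp U) F)).
  rewrite sep_opp_comp //; apply/setP => X; rewrite inE; apply/and3P/faces_offP.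
    case=> XL UX XF; split=> // i iU.
    by rewrite -(svleP UX) // (svleP UF).
  case=> XL XF XE; split=> //; apply/svleP => i iU; rewrite XE //.
  exact: (svleP UF).
apply: exact_faces_off => //.
- by rewrite (om_comp hL) ?(om_opp hL).
- by rewrite supp_comp supp_opp; apply/setUidPr/svle_supp.
rewrite sep_opp_comp //; apply: contraNneq nUF => Es; apply/eqP/svle_eq_supp => //.
by rewrite Es.
Qed.

End Sweep.

(** * Incidence functions *)

Section IncidenceExtension.

Local Open Scope ring_scope.

Variables (E : finType) (L : {set signvec E}).
Hypothesis hL : oriented_matroid L.
Implicit Types (X Y Z U V W F G T : signvec E) (s : {set E}).

(** * Attaching one cell to a complex with incidence numbers *)

Section OneCell.

Variables (D : {set signvec E}) (inc : signvec E -> signvec E -> int).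
Hypotheses (hD : face_closed L D) (hinc : incidence_function (@svle E) D inc).
Variable T : signvec E.
Hypotheses (TL : T \in L) (TD : T \notin D).
Hypothesis subT : forall X, X \in L -> svle X T -> X != T -> X \in D.

Let K G := [set X in L | svle X T] :\: [set G; T].

Let inc_leD := inc_le hL hD hinc.
Let inc_sqD := inc_sq hinc.

(** The starting position V = T of the sweep, where nothing has been crossed. *)
Lemma exact_punctured G : cover L G T -> exact_on D inc int (K G).
Proof.
move=> cGT.
have sTT : sep T T = set0.
  by apply/setP => i; rewrite !inE; case: (T i) => [[]|].
have -> : K G = faces_off L T (sep T T) :\: [set G; T].
  congr (_ :\: _); apply/setP => X; rewrite sTT; apply/setIdP/faces_offP.
    by case=> XL XT; split=> // i; rewrite inE.
  by case.
apply: (exact_faces_off_punctured hL hD hinc cGT) => // F' V F'L F'T nF'T VL EV ns.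
apply: (exact_faces_off hL hD hinc) => //; exact: subT.
Qed.

Lemma in_punctured G X :
  reflect [/\ X \in L, svle X T, X != G & X != T] (X \in K G).
Proof.
rewrite in_setD in_set2 negb_or in_set -andbA.
by apply: (iffP and4P) => [[? ? ? ?]|[? ? ? ?]].
Qed.

(** The boundary of G is a cycle in the punctured boundary of T and is filled there; G minus the
    filling is the required cycle. *)
Lemma facet_cycle_ex G : cover L G T -> exists z : {ffun signvec E -> int},
  [/\ z G = 1, forall X, z X != 0 -> cover L X T & boundary D inc z = 0].
Proof.
move=> cGT; have [GL _ GT nGT GTmax] := coverP cGT.
have GD : G \in D by apply: subT.
pose dG : {ffun signvec E -> int} := [ffun X => (X == G)%:R].
have fE c : boundary D inc dG c = inc G c.
  rewrite ffunE (bigD1 G) //= ffunE eqxx mulr1 intz big1 ?addr0 // => x /andP[_ nx].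
  by rewrite ffunE (negPf nx) mulr0.
have incK x c : x \in D -> svle x T -> (x == G) || (x \in K G) -> inc x c != 0 -> c \in K G.
  move=> xD xT xK /(inc_cover hL hD hinc)[_ cD /coverP[cL xL cx ncx _]].
  apply/in_punctured; split=> //; first exact: svle_trans cx xT.
    case/orP: xK => [/eqP <- //|/in_punctured[_ _ nxG nxT]].
    apply/eqP => cG; rewrite cG in cx.
    by case: (GTmax x xL cx xT) => /eqP; rewrite ?(negPf nxG) ?(negPf nxT).
  by apply/eqP => cT; case/eqP: ncx; apply: svle_anti; rewrite cx cT xT.
have fK : chain_on (K G) (boundary D inc dG).
  move=> c; rewrite fE => cK; apply/eqP; apply: contraR cK.
  by apply: incK => //; rewrite eqxx.
have [h [Kh hr hE]] : exists h : {ffun signvec E -> int}, [/\ chain_on (K G) h,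
    forall c, h c != 0 -> srank L c = srank L G &
    forall c, c \in K G -> boundary D inc h c = boundary D inc dG c].
  (* When G is the empty cell its boundary is zero, and there is no rank below in which to place a
     cycle. *)
  have [r0|r0] := posnP (srank L G).
    exists 0; split=> [c _|c|c _]; [by rewrite ffunE|by rewrite ffunE eqxx|].
    rewrite fE ffunE big1 => [|x _]; last by rewrite ffunE mulr0.
    apply/esym/eqP; apply: contraT => /(inc_srank hL hD hinc).
    by rewrite r0.
  have [|c _|h [Kh hr hE]] := @exact_on_homogeneous _ D inc int (srank L)
    (K G) (srank L G).-1 _ (inc_srank hL hD hinc) (exact_punctured cGT) fK.
  - by move=> c; rewrite fE => /(inc_srank hL hD hinc) ->.
  - by rewrite (boundary_sq inc_sqD) ffunE.
  by exists h; split=> // c /hr; rewrite prednK.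
exists (dG - h); split.
- rewrite !ffunE eqxx Kh ?subr0 //; apply/negP => /in_punctured[_ _].
  by rewrite eqxx.
- move=> X; rewrite !ffunE; have [->|nXG] := eqVneq X G; first by [].
  rewrite sub0r oppr_eq0 => hX; have /in_punctured[XL XT _ _] := chain_in Kh hX.
  by apply: cover_of_srank => //; rewrite (hr X hX); apply: srank_cover.
apply/ffunP => c; rewrite boundaryB [RHS]ffunE.
have [cK|cK] := boolP (c \in K G); first by rewrite hE // subrr.
rewrite fK // sub0r; apply/eqP; rewrite oppr_eq0; apply: contraR cK.
case/boundary_neq0_inc => x /(chain_in Kh) xK.
have /in_punctured[xL xT _ nxT] := xK; apply: incK => //; last by rewrite xK orbT.
exact: subT.
Qed.

(** Without G such a cycle lies in the exact punctured boundary, but a filling would need cells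
    strictly between a facet and T. *)
Lemma facet_cycle_eq0 G (y : {ffun signvec E -> int}) : cover L G T ->
  (forall X, y X != 0 -> cover L X T) -> boundary D inc y = 0 -> y G = 0 -> y = 0.
Proof.
move=> cGT yT y0 yG.
have Ky : chain_on (K G) y.
  move=> c cK; apply/eqP; apply: contraR cK => yc.
  have /coverP[cL _ cT ncT _] := yT c yc; apply/in_punctured; split=> //.
  by apply: contraNneq yc => ->; rewrite yG.
have [c _|h Kh hE] := exact_punctured cGT Ky; first by rewrite y0 ffunE.
apply/ffunP => c; rewrite [RHS]ffunE; apply/eqP; apply: contraT => yc.
have cK := chain_in Ky yc; have := yc; rewrite -hE //.
case/boundary_neq0_inc => x /(chain_in Kh)/in_punctured[xL xT _ nxT].
case/(inc_cover hL hD hinc) => _ _ /coverP[_ _ cx ncx _].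
have /coverP[_ _ _ _ /(_ x xL cx xT)] := yT c yc.
by case=> Ex; [rewrite Ex eqxx in ncx|rewrite Ex eqxx in nxT].
Qed.

(** Let y be the cycle normalised at G. Then y is z multiplied by the integer [y G0]; evaluating at
    G gives 1 as a product of integers with factor [z G]. *)
Lemma facet_cycle_unit G (z : {ffun signvec E -> int}) : cover L G T ->
    (forall X, z X != 0 -> cover L X T) -> boundary D inc z = 0 ->
    (exists2 G0, cover L G0 T & z G0 = 1) ->
  z G = 1 \/ z G = -1.
Proof.
move=> cG zT z0 [G0 cG0 zG0]; have [y [yG yT y0]] := facet_cycle_ex cG.
have y_scale : y - [ffun X => y G0 * z X] = 0.
  apply: (facet_cycle_eq0 cG0); last by rewrite !ffunE zG0 mulr1 subrr.
    move=> X; rewrite !ffunE; have [yX|/yT //] := eqVneq (y X) 0.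
    rewrite yX sub0r oppr_eq0 mulf_eq0 negb_or => /andP[_]; exact: zT.
  rewrite boundaryD boundaryN y0 sub0r; apply/eqP; rewrite oppr_eq0; apply/eqP.
  apply/ffunP => c; rewrite !ffunE; under eq_bigr => x _ do rewrite ffunE mulrCA.
  rewrite -mulr_sumr; have /ffunP/(_ c) := z0; rewrite !ffunE => ->.
  by rewrite mulr0.
have := congr1 (fun u : {ffun signvec E -> int} => u G) y_scale.
rewrite !ffunE yG => /eqP; rewrite subr_eq0 => /eqP/esym E1.
by have := intUnitRing.unitzPl E1; rewrite qualifE => /pred2P.
Qed.

(** The facet cycle becomes the row of T: being a cycle is the vanishing of the squared boundary at
    T. *)
Lemma incidence_extend1 : sv0 E \in D -> exists inc' : signvec E -> signvec E -> int,
  incidence_function (@svle E) (T |: D) inc' /\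
  forall c c', c \in D -> inc' c c' = inc c c'.
Proof.
move=> D0; have [sDL idD] := hD.
have T0 : sv0 E != T by apply: contraNneq TD => <-.
have [G0 cG0 _] := cover_above (om_zero hL) TL (svle0 T) T0.
have [z [zG0 zT z0]] := facet_cycle_ex cG0.
have zunit G : cover L G T -> z G = 1 \/ z G = -1.
  by move=> cG; apply: facet_cycle_unit => //; exists G0.
have hD' : face_closed L (T |: D).
  split; first by rewrite subUset sub1set TL.
  move=> X Y XL; rewrite !in_setU1 => /predU1P[->|YD] XY.
    by have [//|nXT] := eqVneq X T; rewrite subT.
  by rewrite (idD X Y) ?orbT.
have nT c : c \in D -> (c == T) = false by move=> cD; apply: contraNF TD => /eqP <-.
have coverD c c' : c \in D -> cover L c' c -> c' \in D.
  by move=> cD /coverP[c'L _ c'c _ _]; apply: idD c'c.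
pose inc' c c' := if c == T then z c' else inc c c'.
exists inc'; split; last by move=> c c' cD; rewrite /inc' nT.
split.
- move=> c c'; rewrite (facet_cover hL) // => /and3P[_ cD' cov]; rewrite /inc'.
  move: cD'; rewrite in_setU1; have [cT _|_ /= cD] := eqVneq c T.
    by apply: zunit; rewrite -cT.
  by apply: (inc_cover_unit hL hD hinc) => //; apply: coverD cov.
- move=> c c'; apply: contraNeq; rewrite (facet_cover hL) // /inc'.
  have [-> /zT cov|_ /(inc_cover hL hD hinc)[cD c'D ->]] := eqVneq c T; last first.
    by rewrite !in_setU1 cD c'D !orbT.
  have [c'L _ c'T nc'T _] := coverP cov.
  by rewrite !in_setU1 eqxx cov subT // orbT.
- move=> v e; rewrite (facet_cover hL) // => /and3P[eD' vD' cov].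
  have [eL vL _ _ _] := coverP cov.
  rewrite (crank_face_closed hL) // => /eqP; rewrite (srank_eq0 hL) // => /eqP e0.
  (* If T is a vertex, its only facet is the empty cell; this is then G0, where [z] was normalised
     to 1. *)
  rewrite /inc'; move: vD'; rewrite in_setU1; have [vT _|_ /= vD] := eqVneq v T.
    have [G0L _ G0T nG0T _] := coverP cG0; rewrite vT e0 in cov.
    have [_ _ _ _ /(_ G0 G0L (svle0 _) G0T)] := coverP cov.
    by case=> EG; [rewrite e0 -EG|rewrite EG eqxx in nG0T].
  have eD := coverD _ _ vD cov.
  apply: (inc_vertex hinc); first by rewrite (facet_cover hL) // eD vD.
  by rewrite (crank_face_closed hL) //; apply/eqP; rewrite (srank_eq0 hL) // e0.
move=> c c''; rewrite big_setU1 //=.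
have incT0 x : inc x T = 0.
  by apply/eqP; apply: contraNT TD => /inc_leD[].
have zT0 : z T = 0.
  by apply/eqP; apply: contraT => /zT/coverP[_ _ _]; rewrite eqxx.
have -> : inc' c T = 0 by rewrite /inc'; case: ifP.
rewrite mul0r add0r /inc'; have [_|_] := eqVneq c T.
  have /ffunP/(_ c'') := z0; rewrite !ffunE => z0c; rewrite -[RHS]z0c.
  by apply: eq_bigr => x xD; rewrite nT // mulrC intz.
by rewrite -[RHS](inc_sqD c c''); apply: eq_bigr => x xD; rewrite nT.
Qed.

End OneCell.

Lemma incidence_extend (D D2 : {set signvec E}) inc :
    face_closed L D -> face_closed L D2 -> D \subset D2 -> sv0 E \in D ->
    incidence_function (@svle E) D inc ->
  exists inc' : signvec E -> signvec E -> int,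
    incidence_function (@svle E) D2 inc' /\
    forall c c', c \in D -> inc' c c' = inc c c'.
Proof.
have [m] := ubnP #|D2 :\: D|; elim: m D inc => // m IH D inc leD hD hD2 sD D0 hinc.
have [/eqP|/set0Pn[T0 T0D]] := eqVneq (D2 :\: D) set0.
  rewrite setD_eq0 => sD2; exists inc; split=> //.
  by have -> : D2 = D by apply/eqP; rewrite eqEsubset sD sD2.
(* A missing cell of least support has all its proper faces already in [D]. *)
case: (@arg_minnP _ T0 (mem (D2 :\: D)) (fun X => #|supp X|) T0D) => T.
rewrite -[mem _ T]/(T \in D2 :\: D) => /setDP[TD2 TD] Tmin.
have TL := subsetP hD2.1 _ TD2.
have subT X : X \in L -> svle X T -> X != T -> X \in D.
  move=> XL XT nXT; apply: contraT => XD.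
  have XD2 : X \in D2 :\: D by rewrite in_setD XD (hD2.2 X T).
  by have := Tmin X XD2; rewrite leqNgt (proper_card (svle_proper XT nXT)).
have [inc1 [hinc1 E1]] := incidence_extend1 hD hinc TL TD subT D0.
have [||||||inc' [hinc' E']] := IH (T |: D) inc1.
- rewrite -ltnS; apply: leq_trans leD; rewrite ltnS; apply: proper_card.
  apply/properP; split; first by apply: setDS; apply: subsetUr.
  by exists T; rewrite !inE ?TD ?TD2 ?eqxx.
- split; first by rewrite subUset sub1set TL hD.1.
  move=> X Y XL; rewrite !in_setU1 => /predU1P[->|YD] XY.
    by have [//|nXT] := eqVneq X T; rewrite subT.
  by rewrite (hD.2 X Y) ?orbT.
- by [].
- by rewrite subUset sub1set TD2.
- by rewrite in_setU1 D0 orbT.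
- by [].
by exists inc'; split=> // c c' cD; rewrite E' ?E1 // in_setU1 cD orbT.
Qed.

Lemma incidence_function_ex (D : {set signvec E}) :
  face_closed L D -> sv0 E \in D ->
  exists inc, incidence_function (@svle E) D inc.
Proof.
move=> hD D0.
have h0 : face_closed L [set sv0 E].
  split; first by rewrite sub1set (om_zero hL).
  move=> X Y _; rewrite !inE => /eqP -> /svle_supp.
  by rewrite supp_sv0 subset0 supp_eq0.
have [|||inc' [hinc' _]] := @incidence_extend [set sv0 E] D (fun _ _ => 0) h0 hD.
- by rewrite sub1set.
- by rewrite inE.
- have nf c c' : facet (@svle E) [set sv0 E] c' c = false.
    rewrite (facet_cover hL) // !inE; apply/negP => /and3P[/eqP -> /eqP ->].
    by case/coverP => _ _ _; rewrite eqxx.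
  split=> //; try by move=> c c'; rewrite nf.
  by move=> c c''; rewrite big1 // => x _; rewrite mul0r.
by exists inc'.
Qed.

End IncidenceExtension.

(** * The bounded complex *)

Section BoundedComplex.

Variables (E : finType) (L : {set signvec E}) (g : E).
Hypothesis hL : oriented_matroid L.
Implicit Types (X Y Z U V W F G T : signvec E) (s : {set E}).

Notation B := (bounded_covectors L g).

Lemma boundedP X : reflect
  (X \in L /\ forall Y, Y \in L -> Y != sv0 E -> svle Y X -> Y g = splus) (X \in B).
Proof.
rewrite inE; apply: (iffP andP) => -[XL H]; split=> //.
  move=> Y YL Y0 YX; have /implyP := forall_inP H Y YL.
  by rewrite Y0 YX inE YL => /(_ isT)/eqP.
apply/forall_inP => Y YL; apply/implyP => /andP[Y0 YX].
by rewrite inE YL (H Y) /=.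
Qed.

Lemma bounded_face_closed : face_closed L B.
Proof.
split; first by apply/subsetP => X /boundedP[].
move=> X Y XL /boundedP[YL H] XY; apply/boundedP; split=> // Z ZL Z0 ZX.
by apply: H => //; apply: svle_trans XY.
Qed.

Lemma bounded_sv0 : sv0 E \in B.
Proof.
apply/boundedP; split; first exact: om_zero hL.
move=> Y _ Y0 /svle_supp; rewrite supp_sv0 subset0 supp_eq0.
by rewrite (negPf Y0).
Qed.

Lemma bounded_at_infinity X : X \in B -> X != sv0 E -> X g = splus.
Proof. by case/boundedP => XL H X0; apply: H => //; apply: svle_refl. Qed.

Lemma in_bounded_vertices X :
  (X \in bounded_vertices L g) = (X \in cocircuits L) && (X g == splus).
Proof.
rewrite inE [X \in positive_part _ _]inE; case: (boolP (X \in cocircuits L)) => //=.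
by rewrite inE => /andP[-> _].
Qed.

Lemma bounded_vertex_sub X : X \in bounded_vertices L g -> X \in B.
Proof.
rewrite in_bounded_vertices => /andP[]; rewrite inE => /and3P[XL X0 /forall_inP H] /eqP Xg.
apply/boundedP; split=> // Y YL Y0 YX.
by have /implyP := H Y YL; rewrite Y0 YX => /(_ isT)/eqP ->.
Qed.

Lemma bounded_vertex_below X : X \in L -> X g = splus ->
  exists2 Y, Y \in bounded_vertices L g & svle Y X.
Proof.
move=> XL Xg; have gX : g \in supp X by rewrite in_supp Xg.
have [Y [Yc YX gY]] := cocircuit_below hL XL gX.
by exists Y => //; rewrite in_bounded_vertices Yc (svleP YX) // Xg.
Qed.

(** The default is never taken, since [max_face] provides the largest face. For X positive at g,
    this face is zero exactly when X is bounded. *)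
Definition face_at_infinity X : signvec E :=
  odflt (sv0 E) [pick M in L | [&& svle M X, M g == None &
    [forall Y in L, svle Y X && (Y g == None) ==> svle Y M]]].

Lemma face_at_infinityP X : [/\ face_at_infinity X \in L,
  svle (face_at_infinity X) X, face_at_infinity X g = None &
  forall Y, Y \in L -> svle Y X -> Y g = None -> svle Y (face_at_infinity X)].
Proof.
rewrite /face_at_infinity; case: pickP => [M /and4P[ML MX /eqP Mg H]|/=].
  split=> // Y YL YX Yg; have /implyP := forall_inP H Y YL.
  by rewrite YX Yg eqxx; apply.
have [||||M [ML MX /= /eqP Mg Mmax]] := @max_face _ _ hL X (fun Y => Y g == None) (sv0 E).
- by move=> Y Z /eqP Yg /eqP Zg; rewrite svcompE in_supp Yg /= Zg.
- exact: om_zero hL.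
- exact: svle0.
- by rewrite sv0E.
move=> /(_ M)/negbT/negP[]; rewrite ML MX Mg eqxx /=; apply/forall_inP => Y YL.
by apply/implyP => /andP[YX Yg]; apply: Mmax.
Qed.

Lemma face_at_infinity_mono X Y : svle X Y ->
  svle (face_at_infinity X) (face_at_infinity Y).
Proof.
move=> XY; have [ML MX Mg _] := face_at_infinityP X.
by have [_ _ _] := face_at_infinityP Y; apply=> //; apply: svle_trans XY.
Qed.

(** * Acyclicity of fibres and of bounded regions *)

Section Acyclicity.

Variable inc : signvec E -> signvec E -> int.
Hypothesis hinc : incidence_function (@svle E) L inc.
Variable A : nzRingType.

Notation exact_cells := (exact_on L inc A).

Let LL : face_closed L L.
Proof. by split. Qed.

Let incle := inc_le hL LL hinc.
Let incsq := inc_sq hinc.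

(** [face_at_infinity] splits the exact interval [U, T] into fibres over faces containing U. The
    fibre over U is an order ideal, and the others make up an exact complement by induction, so
    [exact_on_sub] applies. *)
Lemma exact_face_at_infinity T U : T \in L -> T g != None ->
  U \in L -> svle U T -> U g = None ->
  exact_cells [set X in L | svle X T & face_at_infinity X == U].
Proof.
move=> TL Tg; have [m] := ubnP #|supp T :\: supp U|; elim: m U => // m IH U leU UL UT Ug.
pose Q := [set X in L | svle U X & svle X T].
pose I := [set X in L | svle X T & face_at_infinity X == U].
have cvQ : convex (@svle E) L Q.
  move=> a b x /[!inE] /and3P[_ Ua _] /and3P[_ _ bT] xL ax xb.
  by rewrite xL (svle_trans Ua ax) (svle_trans xb bT).
have idI : ideal_of (@svle E) Q I.
  split.
    apply/subsetP => X; rewrite !inE => /and3P[-> -> /eqP <-].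
    by have [_ -> _ _] := face_at_infinityP X.
  move=> x y; rewrite !inE => /and3P[xL Ux xT] /and3P[yL yT /eqP yU] xy.
  rewrite xL xT /=; apply/eqP/svle_anti; apply/andP; split.
    by rewrite -yU face_at_infinity_mono.
  by have [_ _ _] := face_at_infinityP x; apply.
apply: (exact_on_sub incle incsq cvQ idI).
  apply: (exact_interval hL LL hinc) => //.
  by apply: contraNneq Tg => <-; rewrite Ug.
apply: (@exact_on_fibres _ (@svle E) L inc incle incsq A _ (@svle E) face_at_infinity
  (fun X => #|supp X|)).
- by move=> x y xy c; apply: svle_eq_supp => //; rewrite -(geq_leqif (subset_leqif_card (svle_supp xy))).
- exact: convexD.
- by move=> x y _ _; apply: face_at_infinity_mono.
move=> x /setDP[]; rewrite !inE => /and3P[xL Ux xT] nI.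
have [ML Mx Mg Mmax] := face_at_infinityP x.
have UM : svle U (face_at_infinity x) by apply: Mmax.
have nUM : U != face_at_infinity x by rewrite eq_sym; move: nI; rewrite xL xT.
(* A face of T with the same face at infinity as x automatically lies above U, so the whole fibre is
   seen inside the interval. *)
suff -> : [set y in Q :\: I | face_at_infinity y == face_at_infinity x] =
    [set y in L | svle y T & face_at_infinity y == face_at_infinity x].
  apply: IH => //; last exact: svle_trans xT.
  rewrite -ltnS; apply: leq_trans leU; rewrite ltnS; apply: proper_card.
  have [_ [i iM iU]] := properP (svle_proper UM nUM).
  apply/properP; split; first by apply/setDS/svle_supp.
  exists i; rewrite !in_setD ?iU ?iM //=.
  by apply: (subsetP (svle_supp (svle_trans Mx xT))).
apply/setP => y; rewrite !in_set.
have [Ey|] := eqVneq (face_at_infinity y) (face_at_infinity x); rewrite ?andbF //.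
rewrite Ey [_ == U]eq_sym (negPf nUM) !andbF !andbT /=.
have [yL|//] := boolP (y \in L); rewrite /= andbC.
have [yT|//] := boolP (svle y T); rewrite /=; apply: svle_trans UM _.
by rewrite -Ey; have [] := face_at_infinityP y.
Qed.

(* Ap and Am are the sets of elements at which the signs + and - are allowed. *)
Definition bounded_region (Ap Am : {set E}) : {set signvec E} :=
  [set X in B | [forall i, ((X i == splus) ==> (i \in Ap)) &&
                           ((X i == sminus) ==> (i \in Am))]].

Definition in_region (Ap Am : {set E}) X : Prop :=
  forall i, (X i = splus -> i \in Ap) /\ (X i = sminus -> i \in Am).

Lemma bounded_regionP Ap Am X :
  reflect (X \in B /\ in_region Ap Am X) (X \in bounded_region Ap Am).
Proof.
rewrite [X \in bounded_region _ _]in_set; apply: (iffP andP) => -[XB H]; split=> //.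
  by move=> i; have /andP[/implyP h1 /implyP h2] := forallP H i; split=> /eqP.
apply/forallP => i; have [h1 h2] := H i.
by apply/andP; split; apply/implyP => /eqP.
Qed.

Lemma in_region_le Ap Am X Y : svle X Y -> in_region Ap Am Y -> in_region Ap Am X.
Proof.
move=> /svleP XY H i; have [h1 h2] := H i.
by split=> Xi; [apply: h1|apply: h2]; rewrite -XY ?in_supp Xi.
Qed.

Lemma ideal_bounded_region Ap Am (Q : {set signvec E}) :
  Q \subset B -> bounded_region Ap Am \subset Q ->
  ideal_of (@svle E) Q (bounded_region Ap Am).
Proof.
move=> sQB sRQ; split=> // x y xQ /bounded_regionP[yB yR] xy.
apply/bounded_regionP; split; first exact: (subsetP sQB).
exact: in_region_le xy yR.
Qed.

Lemma convex_bounded_region Ap Am : convex (@svle E) L (bounded_region Ap Am).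
Proof.
move=> a b x _ /bounded_regionP[bB bR] xL _ xb; apply/bounded_regionP; split.
  exact: bounded_face_closed.2 xb.
exact: in_region_le xb bR.
Qed.

Lemma bounded_region_sub Ap Am : bounded_region Ap Am \subset B.
Proof. by apply/subsetP => X /bounded_regionP[]. Qed.

(** Induction on the number of elements where both signs are allowed. Such an element e splits the
    region into two closed halves meeting on the hyperplane of e; with no such element left, the
    region consists of the bounded faces of one covector. *)
Lemma exact_bounded_region Ap Am X : X \in bounded_region Ap Am -> X != sv0 E ->
  exact_cells (bounded_region Ap Am).
Proof.
have [m] := ubnP #|Ap :&: Am|; elim: m Ap Am X => // m IH Ap Am X leA XR X0.
have [A0|/set0Pn[e]] := eqVneq (Ap :&: Am) set0.
  have [XB XA] := bounded_regionP _ _ _ XR.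
  pose W : signvec E := [ffun i => if i \in Ap then splus else
                                   if i \in Am then sminus else None].
  have regW Y : in_region Ap Am Y <-> svle Y W.
    split=> [YR|/svleP YW i].
      apply/svleP => i; rewrite in_supp ffunE; have [h1 h2] := YR i.
      case: (Y i) h1 h2 => [[]|] // h1 h2 _; first by rewrite h1.
      rewrite h2 //; case: ifP => // iAp; have : i \in Ap :&: Am by rewrite inE iAp h2.
      by rewrite A0 inE.
    have := YW i; rewrite in_supp ffunE.
    by case: (Y i) => [[]|] //= /(_ isT); case: ifP => // _; case: ifP.
  (* W need not be a covector; the largest covector T below it has the same faces in [L]. *)
  have [||||T [TL TW _ Tmax]] := @max_face _ _ hL W predT X => //.
  - by case/boundedP: XB.
  - by apply/regW.
  have XT : svle X T by apply: Tmax => //; [case/boundedP: XB|apply/regW].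
  have Xg := bounded_at_infinity XB X0.
  have Tg : T g = splus by rewrite -(svleP XT) ?in_supp ?Xg.
  have -> : bounded_region Ap Am =
      [set Y in L | svle Y T & face_at_infinity Y == sv0 E].
    apply/setP => Y; rewrite inE; apply/bounded_regionP/and3P.
      case=> YB /regW YW; have [YL Yb] := boundedP _ YB; split=> //; first exact: Tmax.
      have [ML MY Mg _] := face_at_infinityP Y.
      by apply: contraT => M0; have := Yb _ ML M0 MY; rewrite Mg.
    case=> YL YT /eqP Y0; split; last by apply/regW; apply: svle_trans TW.
    apply/boundedP; split=> // Z ZL Z0 ZY; have [_ _ _ Mmax] := face_at_infinityP Y.
    have ZT := svle_trans ZY YT.
    have gZ : g \in supp Z.
      apply: contraT => /notin_supp Zg; have := svle_supp (Mmax Z ZL ZY Zg).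
      by rewrite Y0 supp_sv0 subset0 supp_eq0 (negPf Z0).
    by rewrite (svleP ZT).
  apply: exact_face_at_infinity => //; rewrite ?Tg ?sv0E //.
    exact: om_zero hL.
  exact: svle0.
move=> eA; have [eAp eAm] := setIP eA.
have card1 (S : {set E}) : S \subset (Ap :&: Am) :\ e -> (#|S| < m)%N.
  move=> /subset_leq_card leS; rewrite -ltnS; apply: leq_trans leA.
  by rewrite ltnS (cardsD1 e (Ap :&: Am)) eA add1n ltnS.
pose R1 := bounded_region Ap (Am :\ e).
pose R2 := bounded_region (Ap :\ e) Am.
pose R0 := bounded_region (Ap :\ e) (Am :\ e).
have sub1 Y : in_region Ap (Am :\ e) Y <-> in_region Ap Am Y /\ Y e != sminus.
  split=> [YR|[YR Ye] i].
    split=> [i|]; first by have [h1 h2] := YR i; split=> // /h2/setD1P[].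
    by apply/eqP => /(YR e).2; rewrite !inE eqxx.
  have [h1 h2] := YR i; split=> // Yi; rewrite in_setD1 h2 // andbT.
  by apply: contraNneq Ye => <-; rewrite Yi.
have sub2 A1 Y : in_region (Ap :\ e) A1 Y <-> in_region Ap A1 Y /\ Y e != splus.
  split=> [YR|[YR Ye] i].
    split=> [i|]; first by have [h1 h2] := YR i; split=> // /h1/setD1P[].
    by apply/eqP => /(YR e).1; rewrite !inE eqxx.
  have [h1 h2] := YR i; split=> // Yi; rewrite in_setD1 h1 // andbT.
  by apply: contraNneq Ye => <-; rewrite Yi.
have R1P Y : (Y \in R1) = (Y \in bounded_region Ap Am) && (Y e != sminus).
  apply/bounded_regionP/andP => [[YB /sub1[YR Ye]]|[/bounded_regionP[YB YR] Ye]].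
    by split=> //; apply/bounded_regionP.
  by split=> //; apply/sub1.
have R2P Y : (Y \in R2) = (Y \in bounded_region Ap Am) && (Y e != splus).
  apply/bounded_regionP/andP => [[YB /sub2[YR Ye]]|[/bounded_regionP[YB YR] Ye]].
    by split=> //; apply/bounded_regionP.
  by split=> //; apply/sub2.
have R0P Y : (Y \in R0) = (Y \in R1) && (Y e != splus).
  apply/bounded_regionP/andP => [[YB /sub2[YR Ye]]|[/bounded_regionP[YB YR] Ye]].
    by split=> //; apply/bounded_regionP.
  by split=> //; apply/sub2.
have ex1 Y : Y \in R1 -> Y != sv0 E -> exact_cells R1.
  apply: IH; apply: card1; apply/subsetP => i; rewrite !inE => /and3P[-> -> ->] //.
have ex2 Y : Y \in R2 -> Y != sv0 E -> exact_cells R2.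
  by apply: IH; apply: card1; apply/subsetP => i; rewrite !inE => /andP[/andP[-> ->] ->].
have ex0 Y : Y \in R0 -> Y != sv0 E -> exact_cells R0.
  apply: IH; apply: card1; apply/subsetP => i; rewrite !inE.
  by move=> /andP[/andP[-> ->] /andP[_ ->]].
have sR : bounded_region Ap Am = R1 :|: R2.
  apply/setP => Y; rewrite in_setU R1P R2P -andb_orr.
  by case: (Y e) => [[]|]; rewrite /= ?andbT.
(* A half holding only the empty cell is not exact, but then the region equals the other half. *)
have [/existsP[v /andP[v0 vR]]|/existsPn n1] := boolP [exists v, (v != sv0 E) && (v \in R1)]; last first.
  have -> : bounded_region Ap Am = R2.
    apply/setP => Y; rewrite sR in_setU; have [->|Y0] := eqVneq Y (sv0 E).
      by rewrite R1P R2P sv0E /= !andbT orbb.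
    by have := n1 Y; rewrite Y0 /= => /negPf ->.
  apply: (ex2 X) => //; move: XR; rewrite sR in_setU; have := n1 X.
  by rewrite X0 /= => /negPf ->.
have [/existsP[w /andP[w0 wR]]|/existsPn n2] := boolP [exists v, (v != sv0 E) && (v \in R2)]; last first.
  have -> : bounded_region Ap Am = R1.
    apply/setP => Y; rewrite sR in_setU; have [->|Y0] := eqVneq Y (sv0 E).
      by rewrite R1P R2P sv0E /= !andbT orbb.
    by have := n2 Y; rewrite Y0 /= => /negPf ->; rewrite orbF.
  exact: (ex1 v).
(* The intersection must also have a nonzero cell. If v and w lie strictly on opposite sides of e,
   eliminating e gives a covector of the region with sign + at g, possibly unbounded; a vertex below
   it serves. *)
have [u uR u0] : exists2 u, u \in R0 & u != sv0 E.
  have [ve|ve] := eqVneq (v e) splus; last by exists v => //; rewrite R0P vR.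
  have [we|we] := eqVneq (w e) sminus; last first.
    by exists w => //; rewrite R0P R1P we andbT; move: wR; rewrite R2P.
  have [vB vA] : v \in B /\ in_region Ap Am v.
    by apply/bounded_regionP; move: vR; rewrite R1P => /andP[].
  have [wB wA] : w \in B /\ in_region Ap Am w.
    by apply/bounded_regionP; move: wR; rewrite R2P => /andP[].
  have [vL _] := boundedP _ vB; have [wL _] := boundedP _ wB.
  have vg := bounded_at_infinity vB v0; have wg := bounded_at_infinity wB w0.
  have eS : e \in sep v w by rewrite inE ve we.
  have [Z [ZL Ze ZE]] := om_elim hL vL wL eS.
  have Zg : Z g = splus.
    have /ZE[-> _] : g \notin sep v w by rewrite inE vg wg.
    by rewrite svcompE in_supp vg.
  have ZA : in_region Ap Am Z.
    move=> i; have [v1 v2] := vA i; have [w1 w2] := wA i.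
    have [|/ZE[-> _]] := boolP (i \in sep v w).
      by rewrite inE; move: v1 v2 w1 w2; case: (v i) => [[]|]; case: (w i) => [[]|] //=; auto.
    by rewrite svcompE in_supp; case: (v i) v1 v2 => [[]|].
  have [u uV uZ] := bounded_vertex_below ZL Zg.
  have ue : u e = None.
    by apply: notin_supp; apply/negP => /(subsetP (svle_supp uZ)); rewrite in_supp Ze.
  exists u.
    rewrite R0P R1P ue /= !andbT; apply/bounded_regionP; split.
      exact: bounded_vertex_sub.
    exact: in_region_le uZ ZA.
  by move: uV; rewrite in_bounded_vertices inE => /andP[/and3P[]].
have sR1 : R1 \subset bounded_region Ap Am by rewrite sR subsetUl.
have idR1 : ideal_of (@svle E) (bounded_region Ap Am) R1.
  exact: ideal_bounded_region (bounded_region_sub _ _) sR1.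
apply: (exact_on_glue incle incsq (@convex_bounded_region Ap Am) idR1).
  exact: (ex1 v).
(* Excision: the region modulo one half is the other half modulo the intersection. *)
have -> : bounded_region Ap Am :\: R1 = R2 :\: R0.
  apply/setP => Y; rewrite !in_setD R0P sR in_setU R2P R1P.
  by case: (Y \in bounded_region Ap Am) => //=; case: (Y e) => [[]|].
have sR02 : R0 \subset R2.
  by apply/subsetP => Y; rewrite R0P R1P R2P => /andP[/andP[-> _] ->].
apply: (exact_on_quot incle incsq (@convex_bounded_region _ _)).
- exact: ideal_bounded_region (bounded_region_sub _ _) sR02.
- exact: (ex2 w).
- exact: (ex0 u).
Qed.

End Acyclicity.

End BoundedComplex.

(** * Cellular resolutions *)

Section MonomialDivision.

Local Open Scope ring_scope.

Variables (k : fieldType) (N : nat).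
Implicit Types (p q : {mpoly k[N]}) (m a b : 'X_{1..N}).

Lemma mcoeff_sumX_neq0 (I : eqType) (r : seq I) (P : pred I) (x : I -> k)
    (e : I -> 'X_{1..N}) b :
  (\sum_(i <- r | P i) x i *: 'X_[e i])@_b != 0 ->
  exists i, [/\ i \in r, P i, e i = b & x i != 0].
Proof.
move=> nz; have /hasP[i ir /and3P[Pi /eqP ei xi]] :
    has (fun i => [&& P i, e i == b & x i != 0]) r.
  apply: contraNT nz => /hasPn H; rewrite raddf_sum big_seq_cond big1 //= => i.
  case/andP => /H; rewrite negb_and => /orP[/negP //|] + Pi.
  rewrite mcoeffZ mcoeffX negb_and negbK.
  by case/orP => [/negPf ->|/eqP ->]; rewrite ?mulr0 ?mul0r.
by exists i.
Qed.

Lemma mpolyX_neq0 m : 'X_[m] != 0 :> {mpoly k[N]}.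
Proof.
apply/eqP => /(congr1 (mcoeff m)); rewrite mcoeffX eqxx mcoeff0.
by move/eqP; rewrite oner_eq0.
Qed.

Definition mquo m p : {mpoly k[N]} :=
  \sum_(a <- msupp p) p@_a *: 'X_[(a - m)%MM].

Lemma mquoK m p : (forall a, p@_a != 0 -> (m <= a)%MM) -> p = mquo m p * 'X_[m].
Proof.
move=> H; rewrite [LHS]mpolyE mulr_suml big_seq [RHS]big_seq; apply: eq_bigr => a.
by rewrite mcoeff_msupp => /H ma; rewrite -scalerAl -mpolyXD submK.
Qed.

Lemma mcoeff_mulX_le p m a : (p * 'X_[m])@_a != 0 -> (m <= a)%MM.
Proof.
rewrite {1}[p]mpolyE mulr_suml.
under eq_bigr do rewrite -scalerAl -mpolyXD.
by case/mcoeff_sumX_neq0 => b [_ _ <- _]; apply: lem_addl.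
Qed.

(* Each term of p strictly divisible by m is assigned to one variable that
   can be removed from it. *)
Definition mpart m p (j : 'I_N) : {mpoly k[N]} :=
  \sum_(a <- msupp p | [pick i | (m i < a i)%N] == Some j)
    p@_a *: 'X_[(a - U_(j))%MM].

Lemma mpartK m p : (forall a, p@_a != 0 -> (m <= a)%MM /\ m <> a) ->
  p = \sum_j 'X_j * mpart m p j.
Proof.
move=> H; rewrite [LHS]mpolyE.
under [RHS]eq_bigr do rewrite mulr_sumr big_mkcond.
rewrite exchange_big /= big_seq [RHS]big_seq; apply: eq_bigr => a.
rewrite mcoeff_msupp => /H[ma nma]; case: pickP => [j mj|no]; last first.
  case: nma; apply/mnmP => i; apply/eqP; rewrite eqn_leq (mnm_lepP ma) /=.
  by rewrite leqNgt no.
rewrite (bigD1 j) //= eqxx big1 ?addr0 => [|i nij]; last first.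
  by case: eqP => // -[Eij]; rewrite Eij eqxx in nij.
rewrite -scalerAr -mpolyXD addmC submK // lep1mP -lt0n.
exact: leq_ltn_trans mj.
Qed.

(** The variable is removed only where the exponent exceeds that of m, so divisibility by m
    survives. *)
Lemma mcoeff_mpart m p j b : (forall a, p@_a != 0 -> (m <= a)%MM) ->
  (mpart m p j)@_b != 0 -> (m <= b)%MM /\ p != 0.
Proof.
move=> H /mcoeff_sumX_neq0[a [_ /eqP Ea <- pa]]; split; last first.
  by apply: contraNneq pa => ->; rewrite mcoeff0.
move: Ea; case: pickP => // i mi [Ei]; rewrite Ei in mi.
have /mnm_lepP ma := H a pa; apply/mnm_lepP => x; rewrite mnmBE mnm1E.
have [<-|_] := eqVneq j x; last by rewrite subn0.
by rewrite subn1 -ltnS prednK // (leq_ltn_trans _ mi).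
Qed.

(** With its converse below, this makes membership in a monomial ideal a test on single terms. *)
Lemma monomial_ideal_mcoeff (T : finType) (A : {set T}) lab p a :
  monomial_ideal A lab p -> p@_a != 0 -> exists2 t, t \in A & (lab t <= a)%MM.
Proof.
case=> q -> ; rewrite raddf_sum /= => nz.
have /exists_inP[t tA /mcoeff_mulX_le ta] :
    [exists t in A, (q t * 'X_[lab t])@_a != 0].
  apply: contraNT nz => /exists_inPn H; rewrite big1 // => t tA.
  by have := H t tA; rewrite negbK => /eqP.
by exists t.
Qed.

Lemma monomial_ideal_of_mcoeff (T : finType) (A : {set T}) lab p :
  (forall a, p@_a != 0 -> exists2 t, t \in A & (lab t <= a)%MM) ->
  monomial_ideal A lab p.
Proof.
(* Each term is charged to one chosen generator dividing it, so that no term is counted twice. *)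
move=> H; exists (fun t => \sum_(a <- msupp p | [pick t in A | (lab t <= a)%MM] == Some t)
  p@_a *: 'X_[(a - lab t)%MM]).
rewrite [LHS]mpolyE.
under [RHS]eq_bigr do rewrite mulr_suml big_mkcond.
rewrite exchange_big /= big_seq [RHS]big_seq; apply: eq_bigr => a.
rewrite mcoeff_msupp => /H[t0 t0A t0a]; case: pickP => [t /andP[tA ta]|/(_ t0)].
  rewrite (bigD1 t) //= eqxx big1 ?addr0 => [|i /andP[_ nit]]; last first.
    by case: eqP => // -[Eij]; rewrite Eij eqxx in nit.
  by rewrite -scalerAl -mpolyXD submK.
by rewrite t0A t0a.
Qed.

End MonomialDivision.

(** * From an ideal complex to a minimal free resolution *)

Section CellularResolution.

Local Open Scope ring_scope.

Variables (T : finType) (le : rel T) (D : {set T}) (inc : T -> T -> int).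
Hypothesis le_trans : transitive le.
Hypothesis hinc : incidence_function le D inc.
Variables (k : fieldType) (N : nat) (lab : T -> 'X_{1..N}).
Variable o : T.
Hypotheses (oD : o \in D) (o_le : forall c, c \in D -> le o c).
Hypothesis o_rank : forall c, c \in D -> (crank le D c == 0%N) = (c == o).

Notation bd := (boundary D inc).
Notation lbl := (cell_label le D lab).
Notation rk := (crank le D).
Notation M := (cellular_module le D lab (k := k)).
Notation chains := {ffun T -> {mpoly k[N]}}.

Lemma inc_facet_of c c' : inc c c' != 0 -> facet le D c' c.
Proof. by apply: contraNT => /(inc_nonfacet hinc) ->. Qed.

Lemma cell_label_leP c m : reflect
  (forall v, v \in complex_vertices le D -> le v c -> (lab v <= m)%MM) (lbl c <= m)%MM.
Proof.
have lblE i : lbl c i = (\max_(v in complex_vertices le D | le v c) lab v i)%N.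
  apply: (big_morph (fun m : 'X_{1..N} => m i)) => [x y|]; first by rewrite mnmE.
  by rewrite mnm0E.
apply: (iffP mnm_lepP) => [H v vV vc|H i].
  apply/mnm_lepP => i; move: (H i); rewrite lblE => /bigmax_leqP; apply.
  by rewrite vV.
by rewrite lblE; apply/bigmax_leqP => v /andP[vV vc]; apply/mnm_lepP/H.
Qed.

Lemma cell_label_mono c' c : le c' c -> (lbl c' <= lbl c)%MM.
Proof.
move=> c'c; apply/cell_label_leP => v vV vc'.
by have /cell_label_leP := lepm_refl (lbl c); apply=> //; apply: le_trans c'c.
Qed.

(** Read in a fixed degree a, this says that the coefficients form a cellular chain over the field
    on the sublevel complex of a. *)
Lemma cellular_moduleP r (f : chains) : M r f <->
  (forall c a, (f c)@_a != 0 -> [/\ c \in D, rk c = r & (lbl c <= a)%MM]).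
Proof.
split=> [Mf c a fca|H c].
  have [[q Eq] /(_ _)[]] := Mf c.
    by apply: contraNneq fca => ->; rewrite mcoeff0.
  by split=> //; move: fca; rewrite Eq; apply: mcoeff_mulX_le.
split; first by exists (mquo (lbl c) (f c)); apply: mquoK => a /H[].
rewrite -msupp_eq0; case E: (msupp (f c)) => [//|a s] _.
have : a \in msupp (f c) by rewrite E mem_head.
by rewrite mcoeff_msupp => /H[].
Qed.

Definition coefs a (f : chains) : {ffun T -> k} := [ffun c => (f c)@_a].

Definition monomial_chain a (u : {ffun T -> k}) : chains := [ffun c => u c *: 'X_[a]].

Lemma coefs_boundary a f : coefs a (bd f) = bd (coefs a f).
Proof.
apply/ffunP => c; rewrite !ffunE raddf_sum; apply: eq_bigr => x _ /=.
by rewrite ffunE !mulrzl raddfMz.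
Qed.

Lemma boundary_monomial_chain a u : bd (monomial_chain a u) = monomial_chain a (bd u).
Proof.
apply/ffunP => c; rewrite !ffunE scaler_suml; apply: eq_bigr => x _ /=.
by rewrite ffunE !mulrzl -scalerMzl.
Qed.

Lemma cellular_module_boundary r f : M r.+1 f -> M r (bd f).
Proof.
move=> /cellular_moduleP Mf; apply/cellular_moduleP => c' a.
have -> : (bd f c')@_a = bd (coefs a f) c' by rewrite -coefs_boundary [RHS]ffunE.
case/boundary_neq0_inc => c; rewrite ffunE => /Mf[cD rc lca].
move=> /inc_facet_of/and4P[c'D _ c'c]; rewrite rc eqSS => /eqP <-.
by split=> //; apply: lepm_trans (cell_label_mono c'c) lca.
Qed.

Lemma cellular_moduleD r f h : M r f -> M r h -> M r (f + h).
Proof.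
move=> /cellular_moduleP Mf /cellular_moduleP Mh; apply/cellular_moduleP => c a.
rewrite ffunE mcoeffD; have [->|/Mf //] := eqVneq (f c)@_a 0.
by rewrite add0r => /Mh.
Qed.

Lemma cellular_module0 r : M r 0.
Proof. by apply/cellular_moduleP => c a; rewrite ffunE mcoeff0 eqxx. Qed.

Lemma cellular_module_exact r f :
  (forall m, (exists2 c, c \in sublevel le D lab m & (0 < rk c)%N) ->
     acyclic le D inc k (sublevel le D lab m)) ->
  M r.+1 f -> bd f = 0 -> exists2 h, M r.+2 h & bd h = f.
Proof.
move=> acyc /cellular_moduleP Mf f0.
have lift1 a : exists2 h, M r.+2 h & bd h = monomial_chain a (coefs a f).
  have chf : cellular_chain le D (sublevel le D lab a) r.+1 (coefs a f).
    by move=> c; rewrite ffunE => /Mf[cD rc lc]; rewrite inE cD.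
  have bf : bd (coefs a f) = 0.
    by rewrite -coefs_boundary f0; apply/ffunP => c; rewrite !ffunE mcoeff0.
  (* Acyclicity is given only for sublevels with a nonempty cell; a nonzero part in degree a
     exhibits one, its rank being positive. *)
  have [E0|/eqP nz] := eqVneq (coefs a f) 0.
    exists 0; first exact: cellular_module0.
    rewrite E0; apply/ffunP => c; rewrite !ffunE scale0r big1 // => x _.
    by rewrite ffunE mulr0.
  have [c fc] : exists c, coefs a f c != 0.
    apply/existsP; apply: contra_notT nz => /existsPn nz.
    by apply/ffunP => c; have := nz c; rewrite negbK => /eqP ->; rewrite ffunE.
  have [|u chu bu] := acyc a _ r.+1 _ chf bf.
    by exists c; have [cA rc] := chf c fc; rewrite ?rc.
  exists (monomial_chain a u); last by rewrite boundary_monomial_chain bu.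
  apply/cellular_moduleP => x b; rewrite ffunE mcoeffZ mcoeffX mulf_eq0 negb_or.
  case/andP => /chu[xA rx]; have [<- _|_] := eqVneq a b; last by rewrite eqxx.
  by move: xA; rewrite inE => /andP[].
have lifts (s : seq 'X_{1..N}) : exists2 h, M r.+2 h &
    bd h = [ffun c => \sum_(a <- s) (f c)@_a *: 'X_[a]].
  elim: s => [|a s [h Mh bh]].
    exists 0; first exact: cellular_module0.
    by apply/ffunP => c; rewrite !ffunE big_nil big1 // => x _; rewrite ffunE mulr0.
  have [h1 Mh1 bh1] := lift1 a; exists (h1 + h); first exact: cellular_moduleD.
  rewrite boundaryD bh1 bh; apply/ffunP => c.
  by rewrite !ffunE big_cons.
(* All degrees occurring in f, each once. *)
pose s := undup (flatten [seq msupp (f c) | c <- enum T]).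
have [h Mh bh] := lifts s; exists h => //; rewrite bh; apply/ffunP => c.
rewrite ffunE; apply/mpolyP => b; rewrite raddf_sum /=.
have [bs|bs] := boolP (b \in s).
  rewrite (bigD1_seq b) ?undup_uniq //= mcoeffZ mcoeffX eqxx mulr1 big1 ?addr0 //.
  by move=> a nab; rewrite mcoeffZ mcoeffX (negPf nab) mulr0.
have -> : (f c)@_b = 0.
  apply: memN_msupp_eq0; apply: contra bs => bs; rewrite mem_undup.
  by apply/flattenP; exists (msupp (f c)) => //; apply/map_f; rewrite mem_enum.
rewrite big_seq big1 // => a sa; rewrite mcoeffZ mcoeffX.
by case: eqP => [ab|]; rewrite ?mulr0 //; rewrite -ab sa in bs.
Qed.

Lemma cellular_module_free r : graded_free (M r).
Proof.
pose S := [set c in D | rk c == r].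
pose b (j : 'I_#|S|) : chains := [ffun c => if c == enum_val j then 'X_[lbl c] else 0].
exists #|S|, b; split.
  move=> j; exists (lbl (enum_val j)) => c; rewrite /homogeneous_poly ffunE.
  by case: eqP => [->|_]; [exists 1; rewrite scale1r|exists 0; rewrite scale0r].
have sumE (s : {ffun 'I_#|S| -> {mpoly k[N]}}) j :
    \sum_i s i * b i (enum_val j) = s j * 'X_[lbl (enum_val j)].
  rewrite (bigD1 j) //= ffunE eqxx big1 ?addr0 // => i nij.
  by rewrite ffunE (inj_eq enum_val_inj) eq_sym (negPf nij) mulr0.
have sum0 (s : {ffun 'I_#|S| -> {mpoly k[N]}}) c : c \notin S ->
    \sum_i s i * b i c = 0.
  move=> cS; rewrite big1 // => i _; rewrite ffunE; case: eqP => [Ec|]; rewrite ?mulr0 //.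
  by rewrite Ec enum_valP in cS.
have enumP c : c \in S -> exists j : 'I_#|S|, c = enum_val j.
  by move=> cS; exists (enum_rank_in cS c); rewrite enum_rankK_in.
move=> f; split=> [/cellular_moduleP Mf|[s [-> _]]].
  exists [ffun j => mquo (lbl (enum_val j)) (f (enum_val j))]; split.
    apply/ffunP => c; rewrite ffunE; have [/enumP[j ->]|cS] := boolP (c \in S).
      by rewrite sumE ffunE; apply: mquoK => a /Mf[].
    rewrite sum0 //; apply/mpolyP => a; rewrite mcoeff0; apply/eqP.
    by apply: contraNT cS => /Mf[cD rc _]; rewrite inE cD rc eqxx.
  move=> s' Ef; apply/ffunP => j; apply: (mulIf (mpolyX_neq0 k (lbl (enum_val j)))).
  rewrite ffunE -mquoK; last by move=> a /Mf[].
  by rewrite -sumE [in LHS]Ef ffunE.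
apply/cellular_moduleP => c a; rewrite ffunE.
have [cS|cS] := boolP (c \in S); last by rewrite sum0 // mcoeff0 eqxx.
have := cS; rewrite inE => /andP[cD /eqP rc]; have [j Ej] := enumP c cS.
by rewrite Ej sumE -Ej => /mcoeff_mulX_le.
Qed.

Lemma homogeneous_polyE a (p : {mpoly k[N]}) :
  homogeneous_poly a p -> p = p@_a *: 'X_[a].
Proof. by case=> x ->; rewrite mcoeffZ mcoeffX eqxx mulr1. Qed.

Lemma homogeneous_boundary a (f : chains) : homogeneous a f -> homogeneous a (bd f).
Proof.
move=> hf; have -> : f = monomial_chain a (coefs a f).
  by apply/ffunP => c; rewrite !ffunE -homogeneous_polyE.
by rewrite boundary_monomial_chain => c; rewrite ffunE; exists (bd (coefs a f) c).
Qed.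

Lemma ideal_complex_resolution (I : {mpoly k[N]} -> Prop) :
    (forall v, v \in complex_vertices le D -> lbl v = lab v) ->
    ideal_complex le D inc lab I ->
  minimal_graded_free_resolution (fun i => M i.+1) (bd (A := {mpoly k[N]}))
    (fun f => bd f o) I.
Proof.
move=> lblV [gen acyc lblN].
have inc_o v : v \in complex_vertices le D -> inc v o = 1.
  rewrite inE => /andP[vD /eqP rv].
  have ro : rk o = 0%N by apply/eqP; rewrite o_rank.
  by apply: (inc_vertex hinc) => //; rewrite /facet oD vD o_le // rv ro.
have augE f : M 1 f -> bd f o = \sum_(v in complex_vertices le D) f v.
  move=> Mf; rewrite ffunE [RHS]big_mkcond [LHS]big_mkcond; apply: eq_bigr => c _ /=.
  rewrite inE; have [cD|//] := boolP (c \in D); case: eqP => [rc|nrc].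
    by rewrite inc_o ?mul1r // inE cD rc.
  have [->|/(Mf c).2[_ rc]] := eqVneq (f c) 0; first by rewrite mulr0.
  by case: nrc.
split.
- by move=> i; apply: cellular_module_free.
- by move=> i f; apply: cellular_module_boundary.
- by move=> i a f _; apply: homogeneous_boundary.
- by move=> a f _ /homogeneous_boundary; apply.
- move=> i f Mf; split=> [|[h _ <-]]; first exact: cellular_module_exact.
  by rewrite (boundary_sq (inc_sum0 hinc)).
- move=> f Mf; split=> [f0|[h _ <-]]; last first.
    by rewrite (boundary_sq (inc_sum0 hinc)) ffunE.
  (* The boundary of f sits in rank 0, so only its coefficient at the empty cell has to vanish. *)
  apply: cellular_module_exact => //; apply/ffunP => c; rewrite [RHS]ffunE.
  apply/eqP; apply: contraT => nz.
  have [cD /eqP] := (cellular_module_boundary Mf c).2 nz.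
  by rewrite o_rank // => /eqP co; rewrite co f0 eqxx in nz.
- move=> p; split=> [/gen[q ->]|[f Mf <-]].
    pose f : chains := [ffun v => if v \in complex_vertices le D then q v * 'X_[lab v] else 0].
    have Mf : M 1 f.
      apply/cellular_moduleP => c a; rewrite ffunE; case: ifP; last by rewrite mcoeff0 eqxx.
      move=> cV /mcoeff_mulX_le; rewrite lblV // => ->.
      by move: cV; rewrite inE => /andP[-> /eqP ->].
    exists f => //; rewrite augE //; apply: eq_bigr => v vV.
    by rewrite ffunE vV.
  apply/gen; exists (fun v => mquo (lab v) (f v)); rewrite augE //.
  apply: eq_bigr => v vV; apply: mquoK => a; rewrite -lblV //.
  by have /cellular_moduleP Mf' := Mf => /Mf'[].
move=> i f Mf; exists (fun j => [ffun c => mpart (lbl c) (bd f c) j]).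
have /cellular_moduleP Mbf := cellular_module_boundary Mf.
split=> [j|].
  apply/cellular_moduleP => c a; rewrite ffunE => /mcoeff_mpart[].
    by move=> b /Mbf[].
  move=> -> /(cellular_module_boundary Mf c).2[cD rc].
  by split.
apply/ffunP => c'; rewrite [RHS]ffunE.
under eq_bigr do rewrite ffunE.
(* A term of the boundary at c' equal to the label of c' would come from a cell c having c' as facet
   and a label dividing that term. The labels of c and c' would then coincide, which [lblN]
   forbids. *)
apply: mpartK => a nz; have [c'D rc' lc'] := Mbf c' a nz; split=> // Ea.
move: nz; have -> : (bd f c')@_a = bd (coefs a f) c' by rewrite -coefs_boundary [RHS]ffunE.
case/boundary_neq0_inc => c; rewrite ffunE => /((cellular_moduleP _ _).1 Mf)[cD rc lca].
move=> /inc_facet_of/and4P[_ _ c'c _]; apply: (lblN c c') => //.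
- by rewrite rc'.
- by apply/eqP => E1; move: rc; rewrite -E1 rc' => /eqP; rewrite eqSS eqn_leq ltnn andbF.
apply/mnmP => x; apply/eqP; rewrite eqn_leq; apply/andP; split.
  by rewrite Ea; apply/mnm_lepP.
exact/mnm_lepP/cell_label_mono.
Qed.

End CellularResolution.

(** * Oriented matroid ideals *)

Section Labels.

Variable n : nat.
Implicit Types (X Y Z : signvec (option 'I_n)) (m : 'X_{1..n + n}).

Lemma sum_option_delta (P : pred (option 'I_n)) (F : option 'I_n -> nat) j :
  (forall e, F e = (e == Some j)) -> (\sum_(e | P e) F e)%N = P (Some j).
Proof.
move=> FE; rewrite big_mkcond (bigD1 (Some j)) //= FE eqxx big1 ?addn0.
  by case: (P _).
by move=> e /negPf ne; rewrite FE ne; case: ifP.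
Qed.

Lemma mxy_lshift Z j : mxy Z (lshift n j) = (Z (Some j) == splus).
Proof.
rewrite mnmDE !mnm_sumE (@sum_option_delta _ _ j) => [|[i|]] /=.
- rewrite big1 ?addn0 // => -[i|] _ /=; last by rewrite mnm0E.
  by rewrite mnm1E eq_rlshift.
- by rewrite mnm1E eq_lshift.
- by rewrite mnm0E.
Qed.

Lemma mxy_rshift Z j : mxy Z (rshift n j) = (Z (Some j) == sminus).
Proof.
rewrite mnmDE !mnm_sumE big1 => [|[i|] _ /=].
- rewrite add0n (@sum_option_delta _ _ j) // => -[i|] /=; last by rewrite mnm0E.
  by rewrite mnm1E eq_rshift.
- by rewrite mnm1E eq_lrshift.
- by rewrite mnm0E.
Qed.

Lemma mxy_leP Z m : (mxy Z <= m)%MM <->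
  (forall j, (Z (Some j) = splus -> 0 < m (lshift n j)) /\
             (Z (Some j) = sminus -> 0 < m (rshift n j))).
Proof.
split=> [/mnm_lepP H j|H].
  split=> Zj; first by have := H (lshift n j); rewrite mxy_lshift Zj.
  by have := H (rshift n j); rewrite mxy_rshift Zj.
apply/mnm_lepP => i; case: (split_ordP i) => j ->.
  rewrite mxy_lshift; case: eqP => // /(H j).1; exact.
rewrite mxy_rshift; case: eqP => // /(H j).2; exact.
Qed.

Lemma svle_mxy X Y : svle X Y -> (mxy X <= mxy Y)%MM.
Proof.
move=> /svleP XY; apply/mxy_leP => j; rewrite mxy_lshift mxy_rshift.
by split=> Xj; rewrite -XY ?in_supp Xj ?eqxx.
Qed.

(** The monomial records every sign except the one at g, which has to be supplied. *)
Lemma mxy_svle X Y : (mxy X <= mxy Y)%MM -> X None = Y None -> svle X Y.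
Proof.
move=> /mxy_leP H XYg; apply/svleP => -[j|] //; rewrite in_supp.
have [] := H j; rewrite mxy_lshift mxy_rshift.
case: (X (Some j)) => [[]|] //= h1 h2 _.
  by move: (h1 erefl); case: eqP => // ->.
by move: (h2 erefl); case: eqP => // ->.
Qed.

Lemma mxy_inj X Y : mxy X = mxy Y -> X None = Y None -> X = Y.
Proof.
move=> E1 E2; apply: svle_anti; rewrite !mxy_svle ?E1 ?E2 //; exact: lepm_refl.
Qed.

End Labels.

Section OrientedMatroidResolution.

Variables (k : fieldType) (n : nat) (L : {set signvec (option 'I_n)}).
Hypothesis hL : oriented_matroid L.
Implicit Types (X Y Z : signvec (option 'I_n)) (m : 'X_{1..n + n}).

Notation B := (bounded_covectors L None).
Notation le := (@svle (option 'I_n)).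
Notation verts := (bounded_vertices L None).
Notation O := (om_ideal k L).

Let hB : face_closed L B := bounded_face_closed L None.

Lemma bounded_vertices_generate : generated_by O verts (@mxy n).
Proof.
move=> p; split=> Op; apply: monomial_ideal_of_mcoeff => a.
  case/(monomial_ideal_mcoeff Op) => Z; rewrite inE => /andP[ZL /eqP Zg] Za.
  have [Y YV YZ] := bounded_vertex_below hL ZL Zg.
  by exists Y => //; apply: lepm_trans (svle_mxy YZ) Za.
case/(monomial_ideal_mcoeff Op) => Y; rewrite inE => /andP[_ YP] Ya.
by exists Y.
Qed.

Lemma bounded_vertices_min_generate :
  minimally_generated_by O verts (@mxy n).
Proof.
split; first exact: bounded_vertices_generate.
move=> A' /properP[sA [v vV vA']] gen.
have Ov : O 'X_[mxy v].
  apply/bounded_vertices_generate; apply: monomial_ideal_of_mcoeff => a.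
  rewrite mcoeffX; have [<- _|_] := eqVneq (mxy v) a; last by rewrite eqxx.
  by exists v => //; apply: lepm_refl.
have := monomial_ideal_mcoeff (a := mxy v) ((gen _).1 Ov).
rewrite mcoeffX eqxx oner_eq0 => /(_ isT)[t tA' tv].
have tV := subsetP sA _ tA'.
have := tV; have := vV; rewrite !in_bounded_vertices => /andP[vc /eqP vg] /andP[tc /eqP tg].
have le_tv : le t v by apply: mxy_svle => //; rewrite vg.
move: vc tc; rewrite !inE => /and3P[_ _ /forall_inP vmin] /and3P[tL t0 _].
(* A remaining generator dividing that of v belongs to a vertex below v, hence to v itself, as v is
   a minimal nonzero covector. *)
have /implyP/(_ _)/eqP Etv := vmin t tL.
by rewrite -Etv ?tA' // ?t0 in vA'.
Qed.

Lemma crank_bounded c : c \in B -> crank le B c = srank L c.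
Proof. exact: crank_face_closed. Qed.

Lemma complex_verticesE : complex_vertices le B = verts.
Proof.
apply/setP => v; apply/setIdP/idP => [[vB]|vV].
  rewrite crank_bounded // => /eqP rv; have [vL _] := boundedP _ _ _ vB.
  have v0 : v != sv0 _ by rewrite -(srank_eq0 hL) // rv.
  have r0 : srank L (sv0 _) = 0 by apply/eqP; rewrite (srank_eq0 hL) ?(om_zero hL).
  have /coverP[_ _ _ _ cv] : cover L (sv0 _) v.
    by apply: cover_of_srank; rewrite ?(om_zero hL) ?svle0 ?r0.
  rewrite in_bounded_vertices (bounded_at_infinity vB v0) eqxx andbT inE vL v0 /=.
  apply/forall_inP => Y YL; apply/implyP => /andP[Y0 Yv].
  by case: (cv Y YL (svle0 Y) Yv) => EY; rewrite EY eqxx // in Y0 *.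
have vB := bounded_vertex_sub vV; split=> //.
have := vV; rewrite in_bounded_vertices inE => /andP[/and3P[vL v0 /forall_inP vmin] _].
rewrite crank_bounded // (@srank_cover _ _ hL (sv0 _) v); last first.
  apply/coverP; split; rewrite ?(om_zero hL) ?svle0 // 1?eq_sym //.
  move=> Y YL _ Yv; have [->|Y0] := eqVneq Y (sv0 _); [by left|right].
  by have /implyP := vmin Y YL; rewrite Y0 Yv => /(_ isT)/eqP.
by rewrite eqSS (srank_eq0 hL) ?(om_zero hL).
Qed.

(** Every element of [supp c] lies in the support of a cocircuit below c, and boundedness of c makes
    this cocircuit a vertex; hence no variable of [mxy c] is lost in the lcm. *)
Lemma cell_labelE c : c \in B -> cell_label le B (@mxy n) c = mxy c.
Proof.
move=> cB; have [cL cb] := boundedP _ _ _ cB.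
have le1 : (cell_label le B (@mxy n) c <= mxy c)%MM.
  by apply/cell_label_leP => v _; apply: svle_mxy.
suff le2 : (mxy c <= cell_label le B (@mxy n) c)%MM.
  by apply/mnmP => i; apply/eqP; rewrite eqn_leq !(mnm_lepP _).
have lab_le v : v \in verts -> le v c -> (mxy v <= cell_label le B (@mxy n) c)%MM.
  rewrite -complex_verticesE => vV vc.
  by have /cell_label_leP := lepm_refl (cell_label le B (@mxy n) c); apply.
have vertex j : Some j \in supp c ->
    exists v, [/\ v \in verts, le v c & v (Some j) = c (Some j)].
  move=> jc; have [v [vc lvc jv]] := cocircuit_below hL cL jc.
  exists v; split=> //; last exact: (svleP lvc).
  rewrite in_bounded_vertices vc; apply/eqP; apply: cb => //; last first.
    by rewrite -supp_eq0; apply/set0Pn; exists (Some j).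
  by move: vc; rewrite inE => /andP[].
apply/mxy_leP => j; split=> cj.
  have [|v [vV vc vj]] := vertex j; first by rewrite in_supp cj.
  by have /mxy_leP/(_ j)[+ _] := lab_le v vV vc; apply; rewrite vj.
have [|v [vV vc vj]] := vertex j; first by rewrite in_supp cj.
by have /mxy_leP/(_ j)[_] := lab_le v vV vc; apply; rewrite vj.
Qed.

Lemma sublevelE m : exists Ap Am : {set option 'I_n},
  sublevel le B (@mxy n) m = bounded_region L None Ap Am.
Proof.
(* A variable dividing m allows the corresponding sign; g has no variable, so nothing is required
   there. *)
exists [set e | if e is Some j then 0 < m (lshift n j) else true].
exists [set e | if e is Some j then 0 < m (rshift n j) else true].
apply/setP => c; apply/setIdP/bounded_regionP => -[cB].
  rewrite cell_labelE // => /mxy_leP H; split=> // -[j|]; rewrite !inE //.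
move=> H; split=> //; rewrite cell_labelE //; apply/mxy_leP => j.
by have := H (Some j); rewrite !inE.
Qed.

(** Exactness is obtained in [L] with the extended incidence function and read back in the bounded
    complex: on chains supported in the region the two boundaries agree. *)
Lemma bounded_sublevel_acyclic inc m : incidence_function le B inc ->
    (exists2 c, c \in sublevel le B (@mxy n) m & 0 < crank le B c) ->
  acyclic le B inc k (sublevel le B (@mxy n) m).
Proof.
move=> hinc [c cm rc]; have [Ap [Am Em]] := sublevelE m; rewrite Em in cm *.
set R := bounded_region _ _ _ _ in cm *.
have sRB : R \subset B := bounded_region_sub _ _ _ _.
have LL : face_closed L L by split.
have cB := subsetP sRB _ cm.
have c0 : c != sv0 _.
  rewrite crank_bounded // in rc; rewrite -(srank_eq0 hL) -?lt0n //.
  exact: (subsetP hB.1).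
have [inc' [hinc' Einc]] := incidence_extend hL hB LL hB.1 (bounded_sv0 None hL) hinc.
have bdE (f : {ffun signvec (option 'I_n) -> k}) :
    chain_on R f -> boundary L inc' f = boundary B inc f.
  move=> Rf; apply/ffunP => x; rewrite !ffunE [LHS]big_mkcond [RHS]big_mkcond.
  apply: eq_bigr => y _; have [yB|yB] := boolP (y \in B).
    by rewrite Einc // (subsetP hB.1).
  have -> : f y = 0%R by apply: Rf; apply: contra yB; apply: (subsetP sRB).
  by rewrite mulr0; case: ifP.
move=> r f chf f0.
have Rf : chain_on R f.
  by move=> x xR; apply/eqP; apply: contraNT xR => /chf[].
have [||h [Rh hr hE]] := @exact_on_homogeneous _ L inc' k (srank L) R r f
    (inc_srank hL LL hinc') (exact_bounded_region hL hinc' cm c0) Rf.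
- by move=> x /chf[xR <-]; rewrite crank_bounded // (subsetP sRB).
- by move=> x _; rewrite bdE // f0 ffunE.
exists h.
  move=> x hx; have xR := chain_in Rh hx.
  by rewrite crank_bounded ?(subsetP sRB) // hr.
(* [exact_on] says nothing outside the region; there the boundary vanishes because the region is
   closed under faces. *)
rewrite -bdE //; apply/ffunP => x; have [/hE //|xR] := boolP (x \in R).
rewrite Rf //; apply/eqP; apply: contraNT xR.
case/boundary_neq0_inc => y /(chain_in Rh)/bounded_regionP[yB yR].
case/(inc_le hL LL hinc') => _ xL xy; apply/bounded_regionP; split.
  exact: hB.2 xy.
exact: in_region_le xy yR.
Qed.

Lemma bounded_ideal_complex inc : incidence_function le B inc ->
  ideal_complex le B inc (@mxy n) O.
Proof.
move=> hinc; split.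
- by rewrite complex_verticesE; apply: bounded_vertices_generate.
- by move=> m; apply: bounded_sublevel_acyclic.
move=> c c' cB c'B rc' c'c nc'c; rewrite !cell_labelE // => Ecc'.
have c'0 : c' != sv0 _.
  rewrite crank_bounded // in rc'; rewrite -(srank_eq0 hL) -?lt0n //.
  exact: (subsetP hB.1).
have c0 : c != sv0 _.
  apply: contraNneq c'0 => E0; move: c'c; rewrite E0 => /svle_supp.
  by rewrite supp_sv0 subset0 supp_eq0.
(* Both cells are nonzero and bounded, so they have the same sign + at infinity and their monomials
   determine them. *)
case/eqP: nc'c; apply: mxy_inj => //.
by rewrite (bounded_at_infinity cB c0) (bounded_at_infinity c'B c'0).
Qed.

End OrientedMatroidResolution.

Theorem theorem2p2 (k : fieldType) (n : nat)
    (L : {set signvec (option 'I_n)})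
    (hM : affine_oriented_matroid L None) :
  let O : {mpoly k[n + n]} -> Prop := om_ideal k L in
  let B : {set signvec (option 'I_n)} := bounded_covectors L None in
  let le : rel (signvec (option 'I_n)) := @svle (option 'I_n) in
  minimally_generated_by O (bounded_vertices L None) (@mxy n) /\
  (exists inc, incidence_function le B inc) /\
  forall inc : signvec (option 'I_n) -> signvec (option 'I_n) -> int,
    incidence_function le B inc ->
    ideal_complex le B inc (@mxy n) O /\
    minimal_graded_free_resolution
      (fun i => cellular_module le B (@mxy n) i.+1)
      (boundary B inc (A := {mpoly k[n + n]}))
      (fun f => boundary B inc f (sv0 (option 'I_n)))
      O.
Proof.
move=> O B le; have [hL _] := hM.
have hB : face_closed L B := bounded_face_closed L None.
have B0 : sv0 _ \in B := bounded_sv0 None hL.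
split; first exact: bounded_vertices_min_generate.
split; first exact: (incidence_function_ex hL hB B0).
move=> inc hinc; have icx := bounded_ideal_complex k hL hinc; split=> //.
apply: ideal_complex_resolution => //.
- exact: svle_trans.
- by move=> c _; apply: svle0.
- move=> c cB; rewrite crank_bounded // (srank_eq0 hL) //.
  exact: (subsetP hB.1).
move=> v; rewrite complex_verticesE // => vV.
by apply: cell_labelE => //; apply: bounded_vertex_sub.
Qed.
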